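(* Let $\Omega$ be a domain in $\mathbb{C}^n$ and let $E\subseteq\Omega$ be a closed subset of Lebesgue measure zero. Let $u$ be a subharmonic function in $\Omega$ which is plurisubharmonic in $\Omega\setminus E$. Then $u$ is plurisubharmonic in the whole of $\Omega$.
   Context: $\mathbb{C}^n$ is identified with $\mathbb{R}^{2n}$; subharmonicity and Lebesgue measure are taken with respect to this identification (so subharmonic means subharmonic for the Laplacian on $\mathbb{R}^{2n}$). Subharmonic and plurisubharmonic functions are upper semicontinuous and are allowed to take the value $-\infty$. The set $E$ is closed in $\Omega$, so that $\Omega\setminus E$ is open and plurisubharmonicity there makes sense. *)

(* Defs.v *)
From HB Require Import structures.
From mathcomp Require Import all_boot all_order all_algebra.
From mathcomp.real_closed Require Import complex.
From mathcomp Require Import all_classical all_reals all_analysis.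

Set Implicit Arguments.
Unset Strict Implicit.
Unset Printing Implicit Defensive.

Import Order.TTheory GRing.Theory Num.Theory numFieldNormedType.Exports.

Local Open Scope classical_set_scope.
Local Open Scope ring_scope.

(* The library only provides these structures on the alias R[i]^o. *)
HB.instance Definition _ (R : rcfType) := NormedModule.copy R[i] R[i]^o.

Section lebesgue_tuple.
Context {R : realType}.
Local Open Scope ereal_scope.

Local Notation mR := (measurableTypeR R).

Section cons.
Variable n : nat.

Definition tuple_consp (x : mR * n.-tuple mR) : n.+1.-tuple mR :=
  [tuple of x.1 :: x.2].

Lemma measurable_tuple_consp : measurable_fun [set: _] tuple_consp.
Proof. exact: measurable_cons. Qed.

Variable mu : {sigma_finite_measure set (n.-tuple mR) -> \bar R}.

Definition lebesgue_cons :=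
  pushforward (@lebesgue_measure R \x mu) tuple_consp.

Let pf : {measure set (n.+1.-tuple mR) -> \bar R} :=
  measure_function_pushforward__canonical__measure_function_Measure
   (@lebesgue_measure R \x mu) measurable_tuple_consp.

HB.instance Definition _ := Measure.copy lebesgue_cons pf.

Let sf : sigma_finite setT lebesgue_cons.
Proof.
have /sigma_finiteP[F [TF ndF Foo]] := sigma_finiteT (@lebesgue_measure R).
have /sigma_finiteP[G [TG ndG Goo]] := sigma_finiteT mu.
pose g (t : n.+1.-tuple mR) : mR * n.-tuple mR := (thead t, [tuple of behead t]).
have gK : cancel g tuple_consp by move=> t; rewrite [RHS]tuple_eta.
have fK : cancel tuple_consp g.
  by move=> [x t]; rewrite /g /= theadE; congr pair; apply/val_inj.
have mg : measurable_fun setT g.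
  apply/measurable_fun_pairP; split.
    exact: measurable_tnth.
  exact: measurable_behead.
exists (fun i => g @^-1` (F i `*` G i)).
  apply/esym/seteqP; split=> // t _.
  have [i _ Fi] : (\bigcup_i F i) (g t).1 by rewrite -TF.
  have [j _ Gj] : (\bigcup_j G j) (g t).2 by rewrite -TG.
  exists (maxn i j) => //; split.
    by move: Fi; exact/subsetPset/ndF/leq_maxl.
  by move: Gj; exact/subsetPset/ndG/leq_maxr.
move=> i; have [mF Fi] := Foo i; have [mG Gi] := Goo i; split.
  by rewrite -[X in measurable X]setTI; apply: mg => //; exact: measurableX.
rewrite /lebesgue_cons /pushforward -comp_preimage.
rewrite (_ : g \o _ = id); last by apply/funext => x /=; rewrite fK.
rewrite preimage_id product_measure1E// lte_mul_pinfty// ge0_fin_numE//.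
Qed.

HB.instance Definition _ := Measure_isSigmaFinite.Build _ _ _ lebesgue_cons sf.

End cons.

Fixpoint lebesgue_tuple n : {sigma_finite_measure set (n.-tuple mR) -> \bar R} :=
  match n with
  | 0 => dirac [tuple]
  | n'.+1 => lebesgue_cons (lebesgue_tuple n')
  end.

Lemma lebesgue_tuple_box n (A : 'I_n -> set mR) :
  (forall i, measurable (A i)) ->
  lebesgue_tuple n [set t | forall i, A i (tnth t i)] =
  \prod_(i < n) lebesgue_measure (A i).
Proof.
elim: n A => [|n IH] A mA.
  rewrite big_ord0 /= /dirac indicE mem_set//.
  by case.
rewrite big_ord_recl -IH//= /lebesgue_cons /pushforward.
rewrite -product_measure1E//; last first.
  rewrite (_ : mkset _ =
    \bigcap_(i in [set: 'I_n]) ((@tnth n mR ^~ i) @^-1` A (lift ord0 i))).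
    apply: fin_bigcap_measurable => // i _.
    by rewrite -[X in measurable X]setTI; exact: measurable_tnth.
  by apply/seteqP; split => t /= H i; [move=> _|]; apply: H.
congr (_ _); apply/seteqP; split => -[x t] /= H.
  by split => [|i]; [have := H ord0|have := H (lift ord0 i); rewrite tnthS].
move=> i; have [->|] := eqVneq i ord0; first exact: H.1.
by rewrite eq_sym => /unlift_some[j -> _]; rewrite tnthS; apply: H.2.
Qed.

End lebesgue_tuple.

Section several_complex_variables.
Context {R : realType}.
Implicit Type n : nat.

(* The identification of R^2n with C^n, real parts listed first. *)
Definition complex_of_tuple n (t : (n + n).-tuple (measurableTypeR R)) :
    'rV[R[i]]_n :=
  \row_j (tnth t (lshift n j) +i* tnth t (rshift n j))%C.

Definition lebesgue_null n (E : set 'rV[R[i]]_n) : Prop :=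
  (lebesgue_tuple (n + n)).-negligible (@complex_of_tuple n @^-1` E).

(* The library norm on 'rV[R[i]]_n is the sup norm: it gives the right
   topology, but mean values have to be taken over Euclidean balls. *)
Definition euclidean_cball n (a : 'rV[R[i]]_n) (r : R) : set 'rV[R[i]]_n :=
  [set z | \sum_j `|z ord0 j - a ord0 j| ^+ 2 <= (r ^+ 2)%:C%C].

Definition ball_mean n (u : 'rV[R[i]]_n -> \bar R) (a : 'rV[R[i]]_n) (r : R) :
    \bar R :=
  let mu := lebesgue_tuple (n + n) in
  let B := @complex_of_tuple n @^-1` euclidean_cball a r in
  (((fine (mu B))^-1)%:E * \int[mu]_(t in B) u (complex_of_tuple t))%E.

Definition usc_on (X : topologicalType) (Om : set X) (u : X -> \bar R) : Prop :=
  forall x (c : R), Om x -> (u x < c%:E)%E ->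
    \forall y \near x, Om y -> (u y < c%:E)%E.

(* Functions are total; only their values on the open set Om matter.  The
   value -oo is allowed, including the constant function -oo.  On a closed
   ball contained in Om such a function is bounded above, so its integral is
   defined, possibly equal to -oo. *)
Definition subharmonic n (Om : set 'rV[R[i]]_n) (u : 'rV[R[i]]_n -> \bar R) :
    Prop :=
  [/\ usc_on Om u,
      forall z, Om z -> (u z < +oo)%E &
      forall a (r : R), 0 < r -> euclidean_cball a r `<=` Om ->
        (u a <= ball_mean u a r)%E].

(* Subharmonicity along all complex lines a + l b; the parameter l ranges over
   C = C^1, represented by 1 x 1 matrices. *)
Definition plurisubharmonic n (Om : set 'rV[R[i]]_n)
    (u : 'rV[R[i]]_n -> \bar R) : Prop :=
  [/\ usc_on Om u,
      forall z, Om z -> (u z < +oo)%E &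
      forall a b : 'rV[R[i]]_n,
        subharmonic [set l : 'rV[R[i]]_1 | Om (a + l *m b)]
                    (fun l => u (a + l *m b))].

Definition domain (X : topologicalType) (Om : set X) : Prop :=
  [/\ open Om, connected Om & Om !=set0].

Definition closed_in (X : topologicalType) (Om E : set X) : Prop :=
  exists2 F, closed F & E = Om `&` F.

End several_complex_variables.

(* Main.v *)
Require Import Defs.
From mathcomp Require Import all_boot all_order all_algebra.
From mathcomp.real_closed Require Import complex.
From mathcomp Require Import all_classical all_reals all_analysis.
From mathcomp Require Import measurable_realfun.
From mathcomp Require Import ring lra.

(** Failure of plurisubharmonicity produces second-order contact from above
    with the wrong sign, and subharmonicity forces the contact points to fill
    a set of positive measure.

    Suppose that the mean value inequality for [u] fails on a disc of the
    complex line [a + C b].  By [harmonic_majorant] there are a circle around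
    the centre and a polynomial [q] of the complex parameter such that [Re q]
    is above [u] on the circle and below [u] at the centre.  Write
    [z = a + l b + t] with [t] orthogonal to [b], and put
    [phi z = Re (q l) - eps |l|^2 + J |t|^2].  On a thin tube around the disc
    and for [J] large, [u - phi] is smaller on the boundary than at the centre
    ([tube_with_boundary_gap]).  So for every small real linear form [p] the
    maximum of [u - phi - p] over the tube is attained at an interior point,
    a contact point of slope [p].

    A contact point [z] outside [E] is impossible.  On a small disc through
    [z] in the direction [b], [u] is subharmonic and lies below
    [phi + p + const], with equality at [z]; but on that disc this bound is a
    harmonic polynomial minus [eps |x|^2] ([test_fun_on_line]), so its mean is
    strictly less than its value at the centre ([ball_mean_harmonic_lt]).

    It remains to find a contact point outside [E]
    ([contact_point_off_null]); this is an Alexandrov-Bakelman-Pucci argument.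
    Let [z1], [z2] be contact points of slopes [p1], [p2].  As [phi] is
    semiconcave, the mean value inequality on the ball of radius [r] around
    [z1] bounds the mean of the gap between [u] and its upper bound at [z1] by
    a multiple of [r^2].  The upper bound touching at [z2] also lies above
    [u], and this leaves room for a difference of slopes of order [|z1 - z2|]
    only ([contact_slope_lipschitz]).  Hence the [N^(2n)] slopes of a grid of
    mesh [kappa / N] have contact points whose mutual distances are at least
    a fixed multiple of [1 / N], and the disjoint cubes around these points
    have a total volume bounded below independently of [N]
    ([packing_nbhd]).  If all of them were in a closed null set, these cubes
    would lie in neighbourhoods of it whose volumes tend to zero
    ([null_nbhd_small]).

    For [harmonic_majorant], inf-convolutions give a Lipschitz majorant of [u]
    whose mean over the disc is still less than the value of [u] at the centre
    ([lipschitz_majorant]).  Plane Lebesgue measure is invariant under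
    rotations, a rotation being a product of three shears
    ([lebesgue_tuple_rotate]); so the mean over the disc does not change when
    the majorant is averaged over [N] equally spaced points of circles, and on
    some circle this average is small.  The Fejer sum built on these [N]
    points is a polynomial whose real part is close to the majorant on that
    circle and takes the average as its value at the centre
    ([fejer_sum_approx]). *)

Set Implicit Arguments.
Unset Strict Implicit.
Unset Printing Implicit Defensive.

Import Order.TTheory GRing.Theory Num.Theory numFieldNormedType.Exports.
Import ComplexField.Normc.

Local Open Scope classical_set_scope.
Local Open Scope ring_scope.

Local Notation Re := complex.Re.
Local Notation Im := complex.Im.

(** * Real coordinates on complex vectors *)

Section complex_modulus.
Context {R : realType}.
Implicit Types x y : R[i].

Lemma normc_ge_Im (x : R[i]) : `|Im x|%:C%C <= `|x|.
Proof.
have := normc_ge_Re (x * 'i%C); rewrite ReiNIm normrN; congr (_ <= _).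
by rewrite normrM (normc_def 'i%C) /= expr0n expr1n add0r sqrtr1 mulr1.
Qed.

Lemma normc_le_ReIm (x : R[i]) (e : R) : `|Re x| < e -> `|Im x| < e -> `|x| < (2 * e)%:C%C.
Proof.
case: x => a b /= ae be; rewrite [X in X < _](_ : _ = (Num.sqrt (a ^+ 2 + b ^+ 2))%:C%C); last by rewrite normc_def.
have e0 : 0 < e by apply: le_lt_trans ae.
rewrite ltcR -[ltRHS]ger0_norm; last by rewrite mulr_ge0 // ltW.
rewrite -sqrtr_sqr ltr_sqrt; last by rewrite exprn_gt0 // mulr_gt0.
have h (t : R) : `|t| < e -> t ^+ 2 < e ^+ 2.
  by move=> te; rewrite -(real_normK (num_real _)) ltr_sqr ?nnegrE // ltW.
have := h _ ae; have := h _ be; have := sqr_ge0 e; nra.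
Qed.

Lemma norm_normc x : `|x| = (normc x)%:C%C.
Proof. by []. Qed.

Lemma normcX x k : normc (x ^+ k) = normc x ^+ k.
Proof. by apply: (@complexI R); rewrite rmorphXn /= -!norm_normc normrX. Qed.

Lemma normc_ge0 x : 0 <= normc x.
Proof. by case: x => a b; exact: sqrtr_ge0. Qed.

Lemma Re_realM (k : R) x : Re (k%:C%C * x) = k * Re x.
Proof. by case: x => a b; rewrite /= mul0r subr0. Qed.

Lemma Re_normc_le x : `|Re x| <= normc x.
Proof. by rewrite -lecR; exact: normc_ge_Re. Qed.

Lemma Im_normc_le x : `|Im x| <= normc x.
Proof. by rewrite -lecR; exact: normc_ge_Im. Qed.

Lemma normc_gt0 x : x != 0 -> 0 < normc x.
Proof.
by move=> x0; rewrite lt_neqAle normc_ge0 eq_sym andbT; apply: contraNneq x0 => /eq0_normc ->.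
Qed.

Lemma normc_sqrD x y : normc (x + y) ^+ 2 = normc x ^+ 2 + 2 * Re (x^*%C * y) + normc y ^+ 2.
Proof.
have normc2 t : normc t ^+ 2 = Re t ^+ 2 + Im t ^+ 2.
  by case: t => p q /=; rewrite sqr_sqrtr // addr_ge0 // sqr_ge0.
by rewrite !normc2; case: x y => p q [p' q'] /=; ring.
Qed.

End complex_modulus.

Section real_coordinates.
Context {R : realType} {n : nat}.
Local Notation V := 'rV[R[i]]_n.
Implicit Types (x : R[i]) (z w : V) (k : 'I_(n + n)).

(** Real parts come first, as in [complex_of_tuple]. *)
Definition rcoord z k : R :=
  match fintype.split k with inl j => Re (z ord0 j) | inr j => Im (z ord0 j) end.

Lemma rcoord_tuple t k : rcoord (complex_of_tuple t) k = tnth t k.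
Proof.
rewrite /rcoord /complex_of_tuple; case: splitP => j jk; rewrite !mxE /=;
  by congr tnth; apply/val_inj.
Qed.

Lemma rcoord_lshift z j : rcoord z (lshift n j) = Re (z ord0 j).
Proof. by rewrite /rcoord (unsplitK (inl j)). Qed.

Lemma rcoord_rshift z j : rcoord z (rshift n j) = Im (z ord0 j).
Proof. by rewrite /rcoord (unsplitK (inr j)). Qed.

Lemma rcoordD z w k : rcoord (z + w) k = rcoord z k + rcoord w k.
Proof. by rewrite /rcoord; case: (fintype.split k) => j; rewrite mxE raddfD. Qed.

Lemma rcoordN z k : rcoord (- z) k = - rcoord z k.
Proof. by rewrite /rcoord; case: (fintype.split k) => j; rewrite mxE raddfN. Qed.

Lemma rcoordB z w k : rcoord (z - w) k = rcoord z k - rcoord w k.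
Proof. by rewrite rcoordD rcoordN. Qed.

Lemma rcoord0 k : rcoord 0 k = 0.
Proof. by rewrite /rcoord; case: (fintype.split k) => j; rewrite mxE raddf0. Qed.

Definition tuple_of_complex z : (n + n).-tuple (measurableTypeR R) :=
  [tuple rcoord z k | k < n + n].

Lemma tuple_of_complexK : cancel tuple_of_complex (@complex_of_tuple R n).
Proof.
move=> z; apply/rowP => j; rewrite /complex_of_tuple mxE !tnth_mktuple.
by rewrite rcoord_lshift rcoord_rshift; case: (z _ _).
Qed.

Lemma rcoord_inj z w : rcoord z =1 rcoord w -> z = w.
Proof.
move=> zw; rewrite -[z]tuple_of_complexK -[w]tuple_of_complexK.
by congr complex_of_tuple; apply: eq_from_tnth => k; rewrite !tnth_mktuple zw.
Qed.

Definition of_rcoord (c : 'I_(n + n) -> R) : V := complex_of_tuple [tuple c k | k < n + n].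

Lemma of_rcoordE c k : rcoord (of_rcoord c) k = c k.
Proof. by rewrite rcoord_tuple tnth_mktuple. Qed.

Definition rdot z w : R := \sum_k rcoord z k * rcoord w k.

Definition rnorm2 z : R := rdot z z.

Lemma rdotC z w : rdot z w = rdot w z.
Proof. by apply: eq_bigr => k _; rewrite mulrC. Qed.

Lemma rdotDl z1 z2 w : rdot (z1 + z2) w = rdot z1 w + rdot z2 w.
Proof. by rewrite -big_split /=; apply: eq_bigr => k _; rewrite rcoordD mulrDl. Qed.

Lemma rdotNl z w : rdot (- z) w = - rdot z w.
Proof. by rewrite -sumrN; apply: eq_bigr => k _; rewrite rcoordN mulNr. Qed.

Lemma rdotBl z1 z2 w : rdot (z1 - z2) w = rdot z1 w - rdot z2 w.
Proof. by rewrite rdotDl rdotNl. Qed.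

Lemma rdotDr z w1 w2 : rdot z (w1 + w2) = rdot z w1 + rdot z w2.
Proof. by rewrite rdotC rdotDl !(rdotC z). Qed.

Lemma rdotNr z w : rdot z (- w) = - rdot z w.
Proof. by rewrite rdotC rdotNl rdotC. Qed.

Lemma rdotBr z w1 w2 : rdot z (w1 - w2) = rdot z w1 - rdot z w2.
Proof. by rewrite rdotDr rdotNr. Qed.

Lemma rdot0r z : rdot z 0 = 0.
Proof. by rewrite /rdot big1 // => k _; rewrite rcoord0 mulr0. Qed.

Lemma rnorm2_ge0 z : 0 <= rnorm2 z.
Proof. by apply: sumr_ge0 => k _; rewrite -expr2 sqr_ge0. Qed.

Lemma rnorm2N z : rnorm2 (- z) = rnorm2 z.
Proof. by rewrite /rnorm2 rdotNl rdotNr opprK. Qed.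

Lemma rnorm2E z : (rnorm2 z)%:C%C = \sum_j `|z ord0 j| ^+ 2.
Proof.
rewrite /rnorm2 /rdot big_split_ord /= -big_split rmorph_sum; apply: eq_bigr => j _.
by rewrite !rcoord_lshift !rcoord_rshift -add_Re2_Im2 !expr2.
Qed.

Definition cdot z w : R[i] := \sum_j z ord0 j * (w ord0 j)^*%C.

(** Every real linear form is the real part of a complex linear one. Real
    linear perturbations therefore restrict to harmonic functions on complex
    lines, while their size is measured in the real coordinates. *)
Lemma rdot_Re_cdot z w : rdot z w = Re (cdot w z).
Proof.
rewrite /rdot /cdot big_split_ord /= raddf_sum -big_split /=; apply: eq_bigr => j _.
rewrite !rcoord_lshift !rcoord_rshift.
by case: (z _ _) (w _ _) => [a b] [c d] /=; ring.
Qed.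

Lemma cdotDl z z' w : cdot (z + z') w = cdot z w + cdot z' w.
Proof. by rewrite -big_split; apply: eq_bigr => j _; rewrite mxE mulrDl. Qed.

Lemma cdotZl x z w : cdot (x *: z) w = x * cdot z w.
Proof. by rewrite /cdot mulr_sumr; apply: eq_bigr => j _; rewrite mxE mulrA. Qed.

Lemma cdotBl z z' w : cdot (z - z') w = cdot z w - cdot z' w.
Proof. by rewrite cdotDl -scaleN1r cdotZl mulN1r. Qed.

Lemma cdotZr x z w : cdot z (x *: w) = x^*%C * cdot z w.
Proof.
rewrite /cdot mulr_sumr; apply: eq_bigr => j _.
by rewrite mxE [in LHS]rmorphM mulrCA.
Qed.

Lemma cdot_self z : cdot z z = (rnorm2 z)%:C%C.
Proof. by rewrite rnorm2E; apply: eq_bigr => j _; rewrite sqr_normc. Qed.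

Lemma cdot0l w : cdot 0 w = 0.
Proof. by rewrite /cdot big1 // => j _; rewrite mxE mul0r. Qed.

Lemma rnorm2Z x z : rnorm2 (x *: z) = normc x ^+ 2 * rnorm2 z.
Proof.
apply: (@complexI R); rewrite rnorm2E rmorphM rmorphXn /= rnorm2E mulr_sumr.
by apply: eq_bigr => j _; rewrite mxE normrM exprMn.
Qed.

Lemma euclidean_cballE (a : V) r :
  euclidean_cball a r = [set z | rnorm2 (z - a) <= r ^+ 2].
Proof.
apply/seteqP; split => z /=.
  move=> h; rewrite -lecR rnorm2E; apply: le_trans h; rewrite le_eqVlt; apply/orP; left.
  by apply/eqP; apply: eq_bigr => j _; rewrite !mxE.
rewrite -lecR rnorm2E; apply: le_trans; rewrite le_eqVlt; apply/orP; left.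
by apply/eqP; apply: eq_bigr => j _; rewrite !mxE.
Qed.

Lemma rcoord2_le z k : rcoord z k ^+ 2 <= rnorm2 z.
Proof.
rewrite /rnorm2 /rdot (bigD1 k) //= -expr2 lerDl.
by apply: sumr_ge0 => i _; rewrite -expr2 sqr_ge0.
Qed.

Lemma rnorm2D z w : rnorm2 (z + w) = rnorm2 z + 2 * rdot z w + rnorm2 w.
Proof. by rewrite /rnorm2 !rdotDl !rdotDr (rdotC w z); ring. Qed.

Lemma rnorm2_eq0 z : rnorm2 z <= 0 -> z = 0.
Proof.
move=> z0; apply: rcoord_inj => k; rewrite rcoord0; apply/eqP.
by rewrite -sqrf_eq0 eq_le sqr_ge0 andbT (le_trans (rcoord2_le z k)).
Qed.

Lemma rdotZl (k : R) z w : rdot (k%:C%C *: z) w = k * rdot z w.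
Proof.
rewrite !rdot_Re_cdot cdotZr -Re_realM; congr (Re (_ * _)).
by rewrite /= oppr0.
Qed.

Lemma rcoord_le_cball z k r : 0 <= r -> rnorm2 z <= r ^+ 2 -> `|rcoord z k| <= r.
Proof.
move=> r0 zr; rewrite -(ger0_norm r0) -ler_sqr ?nnegrE// !real_normK ?num_real//.
exact: le_trans (rcoord2_le z k) zr.
Qed.

Lemma rnorm2_le z r : (forall k, `|rcoord z k| <= r) -> rnorm2 z <= (n + n)%:R * r ^+ 2.
Proof.
move=> zr; rewrite /rnorm2 /rdot -[X in X%:R]card_ord mulr_natl -sumr_const.
apply: ler_sum => k _; rewrite -expr2 -(real_normK (num_real _)).
by rewrite ler_sqr ?nnegrE // (le_trans _ (zr k)).
Qed.

Lemma rdot_le z w a b : (forall k, `|rcoord z k| <= a) ->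
  (forall k, `|rcoord w k| <= b) -> `|rdot z w| <= (n + n)%:R * (a * b).
Proof.
move=> za wb; rewrite /rdot -[X in X%:R]card_ord mulr_natl -sumr_const.
apply: le_trans (ler_norm_sum _ _ _) _; apply: ler_sum => k _.
by rewrite normrM ler_pM.
Qed.

(** Open cubes rather than balls: their volume is a product of lengths, and
    they pack without loss. *)
Definition rbox (a : V) (r : R) : set V :=
  [set z | forall k, `|rcoord z k - rcoord a k| < r].

(** The sup norm of complex moduli and the sup norm of the real coordinates
    are equivalent, up to a factor two. All topological arguments below go
    through this description of neighbourhoods. *)
Lemma nbhs_rboxP (a : V) (A : set V) :
  nbhs a A <-> exists2 r : R, 0 < r & rbox a r `<=` A.
Proof.
split.
  move=> /nbhs_ballP[e /= e0 eA].
  have e0' : 0 < Re e by move: e0; rewrite ltcE => /andP[_].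
  have eE : e = (Re e)%:C%C by rewrite RRe_real // gtr0_real.
  exists (Re e / 2) => [|z az]; first by rewrite divr_gt0.
  apply: eA; split => // i j; rewrite (ord1 i) -ball_normE /= eE.
  rewrite (_ : Re e = 2 * (Re e / 2)); last by field.
  rewrite distrC; apply: normc_le_ReIm; rewrite raddfB.
    by have := az (lshift n j); rewrite !rcoord_lshift.
  by have := az (rshift n j); rewrite !rcoord_rshift.
move=> [r r0 rA]; apply/nbhs_ballP; exists r%:C%C => /=; first by rewrite ltcR.
move=> z [_ az]; apply: rA => k; rewrite -rcoordB /rcoord.
case: (fintype.split k) => j; have := az ord0 j; rewrite -ball_normE /= distrC => h;
  rewrite !mxE -ltcR.
  exact: le_lt_trans (normc_ge_Re _) h.
exact: le_lt_trans (normc_ge_Im _) h.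
Qed.

End real_coordinates.

(** * Semicontinuity, compactness and measurability *)

(** Instance resolution does not see through the structures on [R[i]]; without
    these two instances, limits in [R[i]] and in its row vectors are stuck. *)
#[global] Instance nbhs_complex_filter (R : realType) (x : R[i]) : ProperFilter (nbhs x) :=
  nbhs_pfilter x.

#[global] Instance nbhs_complex_row_filter (R : realType) n (z : 'rV[R[i]]_n) :
  ProperFilter (nbhs z) := nbhs_pfilter z.

Section topology.
Context {R : realType}.

Lemma real_between (a b : \bar R) : (a < b)%E ->
  exists2 x : R, (a < x%:E)%E & (x%:E < b)%E.
Proof.
case: a b => [a||] [b||] //=.
- rewrite lte_fin => ab; exists ((a + b) / 2); rewrite lte_fin; lra.
- by move=> _; exists (a + 1); rewrite ?ltry // lte_fin; lra.
- by move=> _; exists (b - 1); rewrite ?ltNyr // lte_fin; lra.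
- by move=> _; exists 0; rewrite ?ltNyr ?ltry.
Qed.

Lemma exists_invn_lt (d : R) : 0 < d -> exists N : nat, N.+1%:R^-1 < d.
Proof.
move=> d0; exists (Num.truncn d^-1); rewrite -[ltRHS]invrK ltf_pV2 ?posrE ?invr_gt0 //.
by have /andP[] := truncn_itv (ltW (eqbRL (invr_gt0 d) d0)).
Qed.

(** If the supremum [s] were not attained, the open sets where [f < c], with
    [c < s], would cover [Q]; compactness would give [f < c] on [Q] for a
    single [c < s]. The filter in the proof is that of left neighbourhoods of
    [s]. *)
Lemma usc_attains_max (X : topologicalType) (Q : set X) (f : X -> \bar R) :
  compact Q -> Q !=set0 -> usc_on Q f ->
  exists2 z, Q z & forall y, Q y -> (f y <= f z)%E.
Proof.
move=> /compact_near_coveringP/near_covering_withinP cQ [z0 Qz0] uf.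
pose s := ereal_sup (f @` Q).
have fs y : Q y -> (f y <= s)%E by move=> Qy; apply: ereal_sup_ubound; exists y.
have [[z Qz sz]|nos] := pselect (exists2 z, Q z & f z = s).
  by exists z => // y Qy; rewrite sz fs.
have lts y : Q y -> (f y < s)%E.
  by move=> Qy; rewrite lt_neqAle fs // andbT; apply/eqP => fys; apply: nos; exists y.
(* Left neighbourhoods of [s]. *)
pose F := filter_from [set c : \bar R | (c < s)%E]
            (fun c => [set c' | (c <= c')%E && (c' < s)%E]).
have FF : Filter F.
  apply: filter_from_filter; first by exists (f z0); exact: lts.
  move=> c d cs ds; exists (Order.max c d) => /=; first by rewrite gt_max cs ds.
  by move=> e /=; rewrite ge_max => /andP[/andP[-> ->] ->].
have [c cs /(_ c)] : F (fun c => Q `<=` (fun y => (f y < c)%E)).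
  apply: (cQ _ F (fun c y => (f y < c)%E)) => x Qx.
  have [c xc cs] := real_between (lts _ Qx).
  exists ([set y | Q y -> (f y < c%:E)%E], [set d | (c%:E <= d)%E && (d < s)%E]).
    by split => /=; [exact: uf|exists c%:E].
  by move=> [y d] /= [fy /andP[cd _]] Qy; exact: lt_le_trans (fy Qy) cd.
rewrite /= lexx cs => /(_ isT) fc; exfalso.
have : (c < s)%E := cs; rewrite ltNge => /negP; apply.
by apply: ge_ereal_sup => _ [y Qy <-]; exact/ltW/fc.
Qed.

Lemma usc_bounded_above (X : topologicalType) (Q : set X) (f : X -> \bar R) :
  compact Q -> usc_on Q f -> (forall z, Q z -> (f z < +oo)%E) ->
  exists M : R, forall z, Q z -> (f z <= M%:E)%E.
Proof.
move=> cQ uf flty; have [Q0|nQ] := pselect (Q !=set0); last first.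
  by exists 0 => z Qz; exfalso; apply: nQ; exists z.
have [z Qz zmax] := usc_attains_max cQ Q0 uf.
exists (fine (f z)) => y Qy; apply: le_trans (zmax y Qy) _.
by case: (f z) (flty z Qz) => [x||] //= _; exact: leNye.
Qed.

Lemma usc_onW (X : topologicalType) (A B : set X) (f : X -> \bar R) :
  A `<=` B -> usc_on B f -> usc_on A f.
Proof.
move=> AB fB x c Ax fc; have := fB x c (AB _ Ax) fc.
by apply: filterS => y h Ay; exact/h/AB.
Qed.

Lemma usc_on_comp (X Y : topologicalType) (A : set Y) (g : X -> Y) (f : Y -> \bar R) :
  continuous g -> usc_on A f -> usc_on (g @^-1` A) (f \o g).
Proof. by move=> cg uf x c Ax fc; have := uf (g x) c Ax fc => /(cg x). Qed.

Lemma usc_on_subr (X : topologicalType) (A : set X) (f : X -> \bar R) (g : X -> R) :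
  continuous g -> usc_on A f -> usc_on A (fun x => (f x - (g x)%:E)%E).
Proof.
move=> cg uf x c Ax fc.
have [d [fd dc]] : exists d : R, (f x < d%:E)%E /\ d - g x < c.
  move: fc; case: (f x) => [a||] //=.
    rewrite -EFinB lte_fin => ac; exists ((a + g x + c) / 2); rewrite lte_fin.
    by split; lra.
  by move=> _; exists (c + g x - 1); split; [exact: ltNyr|lra].
have e0 : 0 < c - (d - g x) by rewrite subr_gt0.
near=> y => Ay.
have fy : (f y < d%:E)%E by move: Ay; near: y; exact: uf.
have gy : `|g x - g y| < c - (d - g x).
  by near: y; move/cvgr_dist_lt : (cg x); exact.
move: fy; case: (f y) => [a||] //=; last by move=> _; exact: ltNyr.
rewrite -EFinB !lte_fin => ad; move: gy; rewrite ltr_norml => /andP[_ gy]; lra.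
Unshelve. all: by end_near. Qed.

Context {n : nat}.
Local Notation V := 'rV[R[i]]_n.

Lemma continuous_real_complex : continuous (fun x : R => x%:C%C).
Proof.
move=> x; apply/cvgrPdist_lt => /= e; rewrite ltcE => /andP[/eqP ei e0].
apply/nbhs_ballP; exists (Re e) => //= y xy.
by rewrite -rmorphB (normc_def _%:C%C) /= expr0n addr0 sqrtr_sqr ltcE /= ei eqxx.
Qed.

Lemma continuous_Re : continuous (fun x : R[i] => Re x).
Proof.
move=> x A /nbhs_ballP[e /= e0 eA]; apply/nbhs_ballP; exists e%:C%C => /=.
  by rewrite ltcR.
move=> y xy; apply: eA; rewrite -ball_normE /= -raddfB -ltcR.
exact: le_lt_trans (normc_ge_Re _) xy.
Qed.

Lemma continuous_Im : continuous (fun x : R[i] => Im x).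
Proof.
move=> x A /nbhs_ballP[e /= e0 eA]; apply/nbhs_ballP; exists e%:C%C => /=.
  by rewrite ltcR.
move=> y xy; apply: eA; rewrite -ball_normE /= -raddfB -ltcR.
exact: le_lt_trans (normc_ge_Im _) xy.
Qed.

Lemma continuous_rcoord k : continuous (fun z : V => rcoord z k).
Proof.
rewrite /rcoord; case: (fintype.split k) => j z.
  apply: (@continuous_comp _ _ _ (fun z : V => z ord0 j)).
    exact: coord_continuous.
  exact: continuous_Re.
apply: (@continuous_comp _ _ _ (fun z : V => z ord0 j)).
  exact: coord_continuous.
exact: continuous_Im.
Qed.

Lemma compact_rectangle (a b c d : R) :
  compact [set x : R[i] | Re x \in `[a, b] /\ Im x \in `[c, d]].
Proof.
rewrite (_ : mkset _ = (fun p : R * R => p.1%:C%C + 'i%C * p.2%:C%C) @` (`[a, b] `*` `[c, d])).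
  apply: continuous_compact; last first.
    by apply: compact_setX; exact: segment_compact.
  apply: continuous_subspaceT => p; apply: cvgD.
    by apply: (@continuous_comp (R * R)%type R R[i] fst (fun x => x%:C%C)); [exact: cvg_fst|exact: continuous_real_complex].
  apply: cvgM; first exact: cvg_cst.
  by apply: (@continuous_comp (R * R)%type R R[i] snd (fun x => x%:C%C)); [exact: cvg_snd|exact: continuous_real_complex].
apply/seteqP; split => x /=.
  by move=> [xa xc]; exists (Re x, Im x) => //=; rewrite -complexE.
by move=> [[y z] [/= ya zc] <-]; simpc.
Qed.

Lemma rbox_open (a : V) (r : R) : open (rbox a r).
Proof.
rewrite openE => z az.
apply: (@filter_forall V _ (fun k w => `|rcoord w k - rcoord a k| < r) _ (nbhs_filter z)) => k.
have e0 : 0 < r - `|rcoord z k - rcoord a k| by rewrite subr_gt0.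
near=> w.
have : `|rcoord z k - rcoord w k| < r - `|rcoord z k - rcoord a k|.
  by near: w; move: e0; apply/cvgr_dist_lt/continuous_rcoord.
by have := ler_distD (rcoord z k) (rcoord w k) (rcoord a k); rewrite (distrC (rcoord w k) (rcoord z k)); lra.
Unshelve. all: by end_near. Qed.

Lemma bounded_closed_compactC (A : set V) (r : R) : closed A ->
  (forall z, A z -> forall k, `|rcoord z k| <= r) -> compact A.
Proof.
move=> cA Ar.
pose S := [set x : R[i] | Re x \in `[- r, r] /\ Im x \in `[- r, r]].
have cS : compact [set z : V | forall j, S (z ord0 j)].
  by apply: (@rV_compact R[i] n (fun=> S)) => j; exact: compact_rectangle.
apply: subclosed_compact cA cS _ => z Az j.
by rewrite /S /= !in_itv /= -!ler_norml -rcoord_lshift -rcoord_rshift !Ar.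
Qed.

(** A Lebesgue number lemma, for the points of [Q] in [S] only: the points
    near which [Q] does not meet [S] impose no condition. *)
Lemma compact_uniform_rbox (Q S O : set V) : compact Q ->
  (forall z, Q z -> nbhs z O \/ \forall y \near z, Q y -> ~ S y) ->
  exists2 r : R, 0 < r & forall z, Q z -> S z -> rbox z r `<=` O.
Proof.
move=> /compact_near_coveringP/near_covering_withinP cQ QO.
have : \forall r \near 0^'+, Q `<=` (fun z => S z -> rbox z r `<=` O).
  apply: (cQ _ _ (fun (r : R) z => S z -> rbox z r `<=` O)) => z.
  move=> /QO[/nbhs_rboxP[r r0 rO]|zS]; last first.
    exists ([set y | Q y -> ~ S y], setT); first by split => //; exact: filterT.
    by move=> [y s] /= [yS _] Qy Sy; have := yS Qy Sy.
  exists (rbox z (r / 2), [set s | s < r / 2]).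
    split => /=; first by apply/nbhs_rboxP; exists (r / 2) => //; rewrite divr_gt0.
    by apply: nbhs_right_lt; rewrite divr_gt0.
  move=> [w s] /= [zw sr] _ _ y wy; apply: rO => k.
  have := zw k; have := wy k.
  have := ler_distD (rcoord w k) (rcoord y k) (rcoord z k); lra.
move=> h; near (0 : R)^'+ => r.
exists r; first by near: r; exact: nbhs_right_gt.
by near: r.
Unshelve. all: by end_near. Qed.

Lemma compact_bounded_rcoord (Q : set V) : compact Q ->
  exists2 r : R, 0 < r & forall z, Q z -> forall k, `|rcoord z k| <= r.
Proof.
move=> /compact_near_coveringP/near_covering_withinP cQ.
have : \forall r \near +oo, Q `<=` (fun z => forall k, `|rcoord z k| <= r).
  apply: (cQ _ _ (fun (r : R) z => forall k, `|rcoord z k| <= r)) => z _.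
  exists (rbox z 1, [set s | 1 + \sum_k `|rcoord z k| < s]).
    split => /=; first by apply/nbhs_rboxP; exists 1.
    exact: (nbhs_pinfty_gt (num_real _)).
  move=> [w s] /= [zw sr] _ k; have := zw k; have := ler_distD (rcoord z k) (rcoord w k) 0.
  rewrite !subr0 => h1 h2.
  have h3 : `|rcoord z k| <= \sum_k `|rcoord z k|.
    by rewrite [leRHS](bigD1 k) //= lerDl sumr_ge0.
  apply/ltW/(le_lt_trans h1)/(lt_trans _ sr); lra.
move=> h; near (+oo : set_system R) => r.
exists r; first by near: r; exact: (nbhs_pinfty_gt (num_real _)).
by near: r.
Unshelve. all: by end_near. Qed.

Lemma continuous_entries (X : topologicalType) (f : X -> V) :
  (forall j, continuous (fun x => f x ord0 j)) -> continuous f.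
Proof.
move=> cf x A /nbhs_rboxP[r r0 rA].
have : \forall y \near x, forall k, `|rcoord (f y) k - rcoord (f x) k| < r.
  apply: (@filter_forall X _ (fun k y => `|rcoord (f y) k - rcoord (f x) k| < r) _
    (nbhs_filter x)) => k.
  have ck : rcoord (f y) k @[y --> x] --> rcoord (f x) k.
    rewrite /rcoord; case: (fintype.split k) => j.
      by apply: (@continuous_comp _ _ _ (fun y => f y ord0 j)); [exact: cf|exact: continuous_Re].
    by apply: (@continuous_comp _ _ _ (fun y => f y ord0 j)); [exact: cf|exact: continuous_Im].
  by near=> y; rewrite distrC; near: y; move: r0; apply/cvgr_dist_lt.
by apply: filterS => y h; apply: rA.
Unshelve. all: by end_near. Qed.

Lemma continuous_entry j : continuous (fun z : V => z ord0 j).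
Proof. exact: coord_continuous. Qed.

Lemma continuous_subr_row (a : V) : continuous (fun z : V => z - a).
Proof.
apply: continuous_entries => j.
have -> : (fun z : V => (z - a) ord0 j) = (fun z => z ord0 j - a ord0 j).
  by apply/funext => z; rewrite !mxE.
by move=> z; apply: cvgB; [exact: continuous_entry|exact: cvg_cst].
Qed.

Lemma measurable_rcoord k :
  measurable_fun setT (fun t => rcoord (@complex_of_tuple R n t) k).
Proof.
under eq_fun do rewrite rcoord_tuple; exact: measurable_tnth.
Qed.

Lemma measurable_rbox a r : measurable (@complex_of_tuple R n @^-1` rbox a r).
Proof.
rewrite (_ : _ @^-1` _ = \bigcap_(k in [set: 'I_(n + n)])
  ((fun t => `|rcoord (@complex_of_tuple R n t) k - rcoord a k|) @^-1` [set x | x < r])).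
  apply: fin_bigcap_measurable => // k _.
  rewrite -[X in measurable X]setTI.
  have mf : measurable_fun setT (fun t => `|rcoord (@complex_of_tuple R n t) k - rcoord a k|).
    apply: measurableT_comp => //; apply: measurable_funB => //; exact: measurable_rcoord.
  apply: mf => //; rewrite (_ : mkset _ = `]-oo, r[%classic) //.
by apply/seteqP; split => t /= h k; [move=> _|]; exact: h.
Qed.

(** The sigma-algebra on tuples is generated by the coordinates, so open sets
    are reached through the countably many cubes with rational centres and
    radii of the form [1 / (2 (N + 1))]. *)
Lemma open_measurable_tuple (A : set V) : open A ->
  measurable (@complex_of_tuple R n @^-1` A).
Proof.
move=> oA.
pose B (q : {ffun 'I_(n + n) -> rat} * nat) :=
  rbox (of_rcoord (fun k => ratr (q.1 k)) : V) (q.2.+1%:R^-1 / 2).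
pose F (q : {ffun 'I_(n + n) -> rat} * nat) :=
  if `[< B q `<=` A >] then @complex_of_tuple R n @^-1` B q else set0.
rewrite (_ : _ @^-1` A = \bigcup_q F q).
  apply: countable_bigcupT_measurable; first exact: countableP.
  by move=> q; rewrite /F; case: asboolP => // _; exact: measurable_rbox.
apply/seteqP; split => t /=.
  move=> At; have /nbhs_rboxP[r r0 rA] : nbhs (complex_of_tuple t) A by exact: open_nbhs_nbhs.
  have [N Nr] := exists_invn_lt r0.
  have N0 : 0 < N.+1%:R^-1 / 2 :> R by rewrite divr_gt0.
  have /choice[q qt] k : exists q : rat, `|tnth t k - ratr q| < N.+1%:R^-1 / 2.
    have /rat_in_itvoo[q] : tnth t k - N.+1%:R^-1 / 2 < tnth t k + N.+1%:R^-1 / 2.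
      by rewrite ltrBlDr -addrA ltrDl addr_gt0.
    by rewrite inE /= => qk; exists q; rewrite ltr_distlC.
  exists ([ffun k => q k], N) => //; rewrite /F ifT.
    by move=> k /=; rewrite of_rcoordE ffunE rcoord_tuple.
  apply/asboolP => z Bz; apply: rA => k; have := Bz k; have := qt k.
  rewrite /= of_rcoordE ffunE rcoord_tuple => h1 h2; apply: lt_trans Nr.
  apply: le_lt_trans (ler_distD (ratr (q k)) _ _) _.
  by rewrite [ltRHS]splitr ltrD // distrC.
by move=> [q _]; rewrite /F; case: asboolP => // qA tq; exact: qA.
Qed.

End topology.

(** * Transformations preserving Lebesgue measure *)

Section measure_preserving.
Context d (T : measurableType d) (R : realType) (mu : {measure set T -> \bar R}).
Implicit Types phi psi : T -> T.

Definition measure_preserving phi :=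
  measurable_fun setT phi /\ forall A, measurable A -> mu (phi @^-1` A) = mu A.

Lemma measure_preserving_comp phi psi : measure_preserving phi ->
  measure_preserving psi -> measure_preserving (phi \o psi).
Proof.
move=> [mphi phiE] [mpsi psiE]; split; first exact: measurableT_comp.
move=> A mA; rewrite comp_preimage psiE ?phiE //.
by rewrite -[X in measurable X]setTI; exact: mphi.
Qed.

Lemma ge0_integral_measure_preserving phi D (f : T -> \bar R) :
  measure_preserving phi -> measurable D -> measurable_fun D f ->
  (forall y, D y -> (0 <= f y)%E) ->
  (\int[mu]_(x in phi @^-1` D) f (phi x) = \int[mu]_(x in D) f x)%E.
Proof.
move=> [mphi phiE] mD mf f0.
rewrite -[LHS](ge0_integral_pushforward mphi _ mD mf); last first.
  by move=> y; rewrite inE; exact: f0.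
by apply: eq_measure_integral => //= A mA AD; exact: phiE.
Qed.

Lemma integral_measure_preserving phi D (f : T -> \bar R) :
  measure_preserving phi -> measurable D -> measurable_fun D f ->
  (\int[mu]_(x in phi @^-1` D) f (phi x) = \int[mu]_(x in D) f x)%E.
Proof.
move=> pphi mD mf; rewrite [LHS]integralE [RHS]integralE; congr (_ - _)%E.
  rewrite -(ge0_integral_measure_preserving pphi mD (measurable_funepos mf)).
    by apply: eq_integral => x _; rewrite !funeposE.
  by move=> y _; exact: funepos_ge0.
rewrite -(ge0_integral_measure_preserving pphi mD (measurable_funeneg mf)).
  by apply: eq_integral => x _; rewrite !funenegE.
by move=> y _; exact: funeneg_ge0.
Qed.

End measure_preserving.

Section lebesgue_tuple_invariance.
Context {R : realType}.
Local Notation mR := (measurableTypeR R).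
Local Notation lam := (@lebesgue_measure R).

Lemma measurable_preimage_cons m (A : set (m.+1.-tuple mR)) : measurable A ->
  measurable (@tuple_consp R m @^-1` A).
Proof.
by move=> mA; rewrite -[X in measurable X]setTI; exact: (@measurable_tuple_consp R m).
Qed.

(** Induction on the dimension, slicing along the first coordinate. *)
Lemma lebesgue_tuple_map m (g : 'I_m -> mR -> mR) :
  (forall i, measure_preserving lam (g i)) ->
  measure_preserving (lebesgue_tuple m) (fun t => [tuple g i (tnth t i) | i < m]).
Proof.
elim: m g => [|m IH] g pg.
  have -> : (fun t : 0.-tuple mR => [tuple g i (tnth t i) | i < 0]) = id.
    by apply/funext => t; apply: eq_from_tnth => -[].
  by split => //; exact: measurable_id.
have mG : measurable_fun setT (fun t : m.+1.-tuple mR => [tuple g i (tnth t i) | i < m.+1]).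
  apply/measurable_fun_tnthP => i.
  rewrite (_ : _ \o _ = fun t => g i (tnth t i)); last first.
    by apply/funext => t /=; rewrite tnth_mktuple.
  by apply: measurableT_comp; [exact: (pg i).1|exact: measurable_tnth].
split=> // A mA.
have [mG' G'E] := IH (fun i => g (lift ord0 i)) (fun i => pg (lift ord0 i)).
have mA' := measurable_preimage_cons mA.
pose F (x : mR) := lebesgue_tuple m (xsection (@tuple_consp R m @^-1` A) x).
pose F' (x : mR) := lebesgue_tuple m (xsection (@tuple_consp R m @^-1`
  ((fun t : m.+1.-tuple mR => [tuple g i (tnth t i) | i < m.+1]) @^-1` A)) x).
rewrite -[LHS]/(\int[lam]_x F' x)%E -[RHS]/(\int[lam]_x F x)%E.
transitivity (\int[lam]_x F (g ord0 x))%E; last first.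
  have mF : measurable_fun setT F := measurable_fun_xsection (lebesgue_tuple m) mA'.
  exact: (ge0_integral_measure_preserving (pg ord0) measurableT mF).
apply: eq_integral => x _; rewrite /F -G'E; last exact: measurable_xsection.
congr (lebesgue_tuple m _); apply/funext => t; apply/propext.
rewrite /xsection /= !inE /=.
suff -> : [tuple g i (tnth (tuple_consp (x, t)) i) | i < m.+1] =
  tuple_consp (g ord0 x, [tuple g (lift ord0 i) (tnth t i) | i < m]) by [].
apply: eq_from_tnth => i; rewrite tnth_mktuple.
have [->|] := eqVneq i ord0; first by [].
by rewrite eq_sym => /unlift_some[j -> _]; rewrite !tnthS tnth_mktuple.
Qed.

End lebesgue_tuple_invariance.

Section affine_invariance.
Context {R : realType}.
Local Notation mR := (measurableTypeR R).
Local Notation lam := (@lebesgue_measure R).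

Lemma lebesgue_measure_opp : measure_preserving lam (-%R : mR -> mR).
Proof. by split; [exact: oppr_measurable|exact: lebesgue_measureN]. Qed.

(** Both measures agree on half-open intervals. *)
Lemma lebesgue_measure_shift (c : R) : measure_preserving lam (fun x : mR => x + c : mR).
Proof.
have mc : measurable_fun setT (fun x : mR => x + c : mR) by exact: measurable_funD.
split=> // A mA.
pose nu : {measure set mR -> \bar R} :=
  measure_function_pushforward__canonical__measure_function_Measure lam mc.
rewrite -[LHS]/(nu A); symmetry; apply: (lebesgue_measure_unique (mu := nu)) => // _ [[a b]] _ <-.
rewrite /= [RHS]/(lam _).
rewrite /pushforward (_ : _ @^-1` _ = `]a - c, b - c]%classic); last first.
  by apply/seteqP; split => x /=; rewrite !in_itv /= ltrBlDr lerBrDr.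
rewrite lebesgue_measure_itv -/lam [RHS]lebesgue_measure_itv /= !lte_fin ltrD2r.
case: ifP => // _.
by rewrite -!EFinB; congr EFin; ring.
Qed.

Lemma lebesgue_measure_reflect (c : R) :
  measure_preserving lam (fun x : mR => c - x : mR).
Proof.
have := measure_preserving_comp (lebesgue_measure_shift c) lebesgue_measure_opp.
by congr measure_preserving; apply/funext => x /=; rewrite addrC.
Qed.

Lemma measurable_tuple_cons d (T : measurableType d) m (f : T -> mR) (g : T -> m.-tuple mR) :
  measurable_fun setT f -> measurable_fun setT g ->
  measurable_fun setT (fun x => tuple_consp (f x, g x)).
Proof. exact: measurable_cons. Qed.

(** Slicing along the first coordinate: every slice is moved by a
    measure-preserving map. *)
Lemma lebesgue_tuple_shear_tail m (G : mR -> m.-tuple mR -> m.-tuple mR) :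
  measurable_fun setT (fun t : m.+1.-tuple mR =>
    tuple_consp (thead t, G (thead t) [tuple of behead t])) ->
  (forall x, measure_preserving (lebesgue_tuple m) (G x)) ->
  measure_preserving (lebesgue_tuple m.+1) (fun t : m.+1.-tuple mR =>
    tuple_consp (thead t, G (thead t) [tuple of behead t])).
Proof.
move=> mT pG; split => // A mA.
have mA' := measurable_preimage_cons mA.
rewrite [LHS]/(lebesgue_tuple _ _) /= /lebesgue_cons /pushforward /product_measure1.
apply: eq_integral => x _.
rewrite -[RHS]((pG x).2 _ (measurable_xsection x mA')).
congr (lebesgue_tuple m _); apply/funext => t; apply/propext.
rewrite /xsection /= !inE /=.
suff -> : [tuple of behead (tuple_consp (x, t))] = t by [].
exact/val_inj.
Qed.

(** Slicing along the other coordinates, which requires the product measure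
    in the opposite order: every slice is translated. *)
Lemma lebesgue_tuple_shear_head m (h : m.-tuple mR -> R) :
  measurable_fun setT h ->
  measure_preserving (lebesgue_tuple m.+1) (fun t : m.+1.-tuple mR =>
    tuple_consp (thead t + h [tuple of behead t], [tuple of behead t])).
Proof.
move=> mh.
have mT : measurable_fun setT (fun t : m.+1.-tuple mR =>
    tuple_consp (thead t + h [tuple of behead t], [tuple of behead t])).
  apply: measurable_tuple_cons; last exact: measurable_behead.
  apply: measurable_funD; first exact: measurable_tnth.
  by apply: measurableT_comp => //; exact: measurable_behead.
split => // A mA.
have mA' := measurable_preimage_cons mA.
have E (B : set (m.+1.-tuple mR)) : measurable B -> lebesgue_tuple m.+1 B =
    (\int[lebesgue_tuple m]_t lam (ysection (@tuple_consp R m @^-1` B) t))%E.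
  move=> mB; rewrite -[RHS]/((lam \x^ lebesgue_tuple m)%E (@tuple_consp R m @^-1` B)).
  apply: product_measure_unique => //; last exact: measurable_preimage_cons.
  by move=> B' C mB' mC /=; rewrite product_measure2E.
set phi := (fun t : m.+1.-tuple mR => _).
have mB : measurable (phi @^-1` A) by rewrite -[X in measurable X]setTI; exact: mT.
transitivity (\int[lebesgue_tuple m]_t lam (ysection (@tuple_consp R m @^-1` (phi @^-1` A)) t))%E.
  exact: E mB.
rewrite [RHS](E _ mA).
apply: eq_integral => t _.
rewrite -[RHS]((lebesgue_measure_shift (h t)).2 _ (measurable_ysection t mA')).
congr (lam _); apply/funext => x; apply/propext.
rewrite /ysection /= !inE /= /phi.
suff -> : [tuple of behead (tuple_consp (x, t))] = t by [].
exact/val_inj.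
Qed.

Definition rotate2 (c s : R) (t : (1 + 1).-tuple mR) : (1 + 1).-tuple mR :=
  let x := tnth t ord0 in let y := tnth t ord_max in
  [tuple c * x - s * y; s * x + c * y].

(** A rotation of angle [theta] is the product of a horizontal shear of ratio
    [- tan (theta / 2)], a vertical one of ratio [sin theta], and the first
    one again. The half-turn is the only rotation that this misses. *)
Lemma lebesgue_tuple_rotate (c s : R) : c ^+ 2 + s ^+ 2 = 1 -> c != -1 ->
  measure_preserving (lebesgue_tuple (1 + 1)) (rotate2 c s).
Proof.
move=> cs c1; have c1' : 1 + c != 0 by rewrite addrC -subr_eq0 opprK in c1 *.
pose tau := s / (1 + c).
pose Sx (t : 2.-tuple mR) := tuple_consp (thead t + - tau * tnth [tuple of behead t] ord0, [tuple of behead t]).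
have pSx : measure_preserving (lebesgue_tuple 2) Sx.
  apply: (@lebesgue_tuple_shear_head 1 (fun u => - tau * tnth u ord0)).
  by apply: measurable_funM => //; exact: measurable_tnth.
pose G (x : mR) (t : 1.-tuple mR) : 1.-tuple mR := [tuple tnth t i + s * x | i < 1].
pose Sy (t : 2.-tuple mR) := tuple_consp (thead t, G (thead t) [tuple of behead t]).
have pSy : measure_preserving (lebesgue_tuple 2) Sy.
  apply: lebesgue_tuple_shear_tail.
    apply: measurable_tuple_cons; first exact: measurable_tnth.
    apply/measurable_fun_tnthP => i.
    rewrite (_ : _ \o _ = fun t : 2.-tuple mR => tnth [tuple of behead t] i + s * thead t); last first.
      by apply/funext => t; rewrite /= tnth_mktuple.
    apply: measurable_funD.
      apply: (@measurableT_comp _ _ _ _ _ _ (fun t : 1.-tuple mR => tnth t i)).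
        exact: measurable_tnth.
      exact: measurable_behead.
    by apply: measurable_funM => //; exact: measurable_tnth.
  move=> x; apply: (@lebesgue_tuple_map R 1 (fun _ y => y + s * x)) => i.
  exact: lebesgue_measure_shift.
have := measure_preserving_comp pSx (measure_preserving_comp pSy pSx).
congr measure_preserving; apply/funext => t.
have behead0 (u : 2.-tuple mR) : tnth [tuple of behead u] ord0 = tnth u ord_max.
  by rewrite !(tnth_nth 0) /= nth_behead.
have Sx0 u : tnth (Sx u) ord0 = tnth u ord0 - tau * tnth u ord_max :> R.
  by rewrite -behead0 -mulNr.
have Sx1 u : tnth (Sx u) ord_max = tnth u ord_max.
  by rewrite -behead0 (tnth_nth 0) /= [RHS](tnth_nth 0).
have Sy0 u : tnth (Sy u) ord0 = tnth u ord0 by [].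
have Sy1 u : tnth (Sy u) ord_max = tnth u ord_max + s * tnth u ord0 :> R.
  rewrite -!behead0.
  rewrite (_ : [tuple of behead (Sy u)] = G (thead u) [tuple of behead u]); last exact/val_inj.
  by rewrite tnth_mktuple.
have tauE : tau * (1 + c) = s by rewrite /tau divfK.
have staus : s * tau = 1 - c.
  by apply: (mulIf c1'); rewrite -mulrA tauE; move: cs; rewrite !expr2 => cs; nra.
apply: eq_from_tnth => i; rewrite /rotate2.
have [->|i1] : i = ord0 \/ i = ord_max.
  by case: i => -[|[|//]] ?; [left|right]; exact/val_inj.
  rewrite /= Sx0 Sy0 Sy1 Sx0 Sx1 [RHS](tnth_nth 0) /=.
  move: (tnth t ord0 : R) (tnth t ord_max : R) => x y.
  rewrite -[in RHS]tauE; rewrite (_ : c = 1 - s * tau) //; first ring.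
  by rewrite staus; ring.
rewrite i1 /= Sx1 Sy1 Sx0 Sx1 [RHS](tnth_nth 0) /=.
move: (tnth t ord0 : R) (tnth t ord_max : R) => x y.
by rewrite (_ : c = 1 - s * tau) //; [ring|rewrite staus; ring].
Qed.

End affine_invariance.

(** * Integrals over Euclidean balls *)

Section integral_monotone.
Local Open Scope ereal_scope.
Context d (T : measurableType d) (R : realType) (mu : {measure set T -> \bar R}).

(** Upper semicontinuous functions on balls are compared with explicit upper
    bounds; stating monotonicity without measurability avoids a discussion of
    their measurability each time. *)
Lemma ge0_integral_mono D (f g : T -> \bar R) :
  (forall x, D x -> 0 <= f x) -> (forall x, D x -> f x <= g x) ->
  \int[mu]_(x in D) f x <= \int[mu]_(x in D) g x.
Proof.
move=> f0 fg; have g0 x : D x -> 0 <= g x by move=> Dx; exact: le_trans (f0 _ Dx) (fg _ Dx).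
rewrite !ge0_integralE // ge_ereal_sup // => _ [h /= hf <-].
apply: le_ereal_sup_tmp; eexists; last exact: lexx.
by exists h => //= x; apply: le_trans (hf x) _; exact: lee_restrict.
Qed.

Lemma integral_mono D (f g : T -> \bar R) : (forall x, D x -> f x <= g x) ->
  \int[mu]_(x in D) f x <= \int[mu]_(x in D) g x.
Proof.
move=> fg; rewrite integralE [leRHS]integralE; apply: leeB.
  apply: ge0_integral_mono => x Dx; first exact: funepos_ge0.
  by rewrite !funeposE ge_max !le_max lexx fg ?orbT.
apply: ge0_integral_mono => x Dx; first exact: funeneg_ge0.
by rewrite !funenegE ge_max !le_max lexx leeN2 fg ?orbT.
Qed.

End integral_monotone.

Section ball_integrals.
Context {R : realType} {n : nat}.
Local Notation V := 'rV[R[i]]_n.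
Local Notation c := (@complex_of_tuple R n).
Local Notation mu := (@lebesgue_tuple R (n + n)).
Implicit Types (a z : V) (r : R).

Lemma continuous_rnorm2 a : continuous (fun z : V => rnorm2 (z - a)).
Proof.
have cB k : continuous (fun z : V => rcoord (z - a) k).
  have -> : (fun z : V => rcoord (z - a) k) = (fun z => rcoord z k - rcoord a k).
    by apply/funext => z; rewrite rcoordB.
  by move=> z; exact: (cvgB (@continuous_rcoord R n k z) (cvg_cst _)).
apply: continuous_big => [|k _ z]; first exact: add_continuous.
exact: (cvgM (cB k z) (cB k z)).
Qed.

Lemma closed_cball a r : closed (euclidean_cball a r).
Proof.
rewrite euclidean_cballE.
by apply: (preimage_closed (D := [set x | x <= r ^+ 2])) => [z _|];
  [exact: continuous_rnorm2|exact: closed_le].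
Qed.

Lemma closed_measurable_tuple (A : set V) : closed A -> measurable (c @^-1` A).
Proof.
move=> cA; rewrite -[A]setCK preimage_setC; apply: measurableC.
exact: (open_measurable_tuple (closed_openC cA)).
Qed.

Lemma measurable_cball a r : measurable (c @^-1` euclidean_cball a r).
Proof. exact: (closed_measurable_tuple (@closed_cball a r)). Qed.

Lemma vol_rbox a r : 0 < r -> mu (c @^-1` rbox a r) = ((2 * r) ^+ (n + n))%:E.
Proof.
move=> r0.
rewrite (_ : _ @^-1` _ = [set t | forall k, `]rcoord a k - r, rcoord a k + r[%classic (tnth t k)]).
  rewrite [LHS](@lebesgue_tuple_box R _ (fun k => `]rcoord a k - r, rcoord a k + r[%classic));
    last by move=> i; exact: measurable_itv.
  rewrite (eq_bigr (fun=> (2 * r)%:E)); last first.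
    move=> k _; rewrite lebesgue_measure_itv /= lte_fin ifT; last by lra.
    by rewrite -EFinB; congr EFin; ring.
  by rewrite prodEFin prodr_const card_ord.
apply/seteqP; split => t /= h k; have := h k;
  by rewrite /= rcoord_tuple in_itv /= ltr_distl.
Qed.

Lemma rbox_sub_cball a r : 0 < r -> rbox a (r / (n + n).+1%:R) `<=` euclidean_cball a r.
Proof.
move=> r0 z az; rewrite euclidean_cballE /=.
have m0 : 0 < (n + n).+1%:R :> R by rewrite ltr0n.
apply: le_trans (rnorm2_le (r := r / (n + n).+1%:R) _) _.
  by move=> k; rewrite rcoordB; exact/ltW/az.
rewrite expr_div_n mulrCA -[leRHS]mulr1 ler_pM2l ?exprn_gt0 // ler_pdivrMr ?exprn_gt0 // mul1r.
rewrite -natrX ler_nat; apply: leq_trans (leqnSn _) _.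
by rewrite -[X in (X <= _)%N]expn1 leq_pexp2l.
Qed.

Lemma cball_sub_rbox a r : 0 < r -> euclidean_cball a r `<=` rbox a (2 * r).
Proof.
move=> r0 z; rewrite euclidean_cballE => /= az k; rewrite -rcoordB.
by apply: le_lt_trans (rcoord_le_cball _ (ltW r0) az) _; rewrite ltr_pMl // ltr1n.
Qed.

Lemma vol_cball_le a r : 0 < r -> (mu (c @^-1` euclidean_cball a r) <= ((4 * r) ^+ (n + n))%:E)%E.
Proof.
move=> r0; rewrite (_ : 4 * r = 2 * (2 * r)); last by ring.
rewrite -(vol_rbox a); last by rewrite mulr_gt0.
apply: le_measure; rewrite ?inE; first exact: measurable_cball.
  exact: measurable_rbox.
by move=> t; exact: cball_sub_rbox.
Qed.

Lemma vol_cball_lty a r : 0 < r -> (mu (c @^-1` euclidean_cball a r) < +oo)%E.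
Proof. by move=> r0; apply: le_lt_trans (vol_cball_le a r0) _; exact: ltry. Qed.

Lemma vol_cball_gt0 a r : 0 < r -> (0 < mu (c @^-1` euclidean_cball a r))%E.
Proof.
move=> r0; have r0' : 0 < r / (n + n).+1%:R by rewrite divr_gt0.
apply: (@lt_le_trans _ _ (mu (c @^-1` rbox a (r / (n + n).+1%:R)))).
  by rewrite vol_rbox // lte_fin exprn_gt0 // mulr_gt0.
apply: le_measure; rewrite ?inE; [exact: measurable_rbox|exact: measurable_cball|].
by move=> t; exact: rbox_sub_cball.
Qed.

Definition vol (A : set V) : R := fine (mu (c @^-1` A)).

Lemma vol_cballE a r : 0 < r -> mu (c @^-1` euclidean_cball a r) = (vol (euclidean_cball a r))%:E.
Proof.
move=> r0; rewrite /vol fineK // ge0_fin_numE ?measure_ge0 //; exact: vol_cball_lty.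
Qed.

Lemma vol_cball_pos a r : 0 < r -> 0 < vol (euclidean_cball a r).
Proof. by move=> r0; rewrite -lte_fin -vol_cballE //; exact: vol_cball_gt0. Qed.

Lemma continuous_measurable_tuple (f : V -> R) : continuous f -> measurable_fun setT (f \o c).
Proof.
move=> cf; apply: (measurability _ (RGenOInfty.measurableE R)) => // _ [_ [x ->] <-].
rewrite setTI comp_preimage; apply: open_measurable_tuple.
by apply: open_comp; [move=> z _; exact: cf|exact: interval_open].
Qed.

Lemma bounded_integrable_cball a r (f : (n + n).-tuple (measurableTypeR R) -> R) M :
  0 < r -> measurable_fun setT f ->
  (forall t, euclidean_cball a r (c t) -> `|f t| <= M) ->
  mu.-integrable (c @^-1` euclidean_cball a r) (EFin \o f).
Proof.
move=> r0 mf fM; apply: measurable_bounded_integrable.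
- exact: measurable_cball.
- exact: vol_cball_lty.
- exact: measurable_funTS.
exists M; split; first exact: num_real.
by move=> x Mx t /= Bt; apply: le_trans (fM _ Bt) (ltW Mx).
Qed.

Lemma integrable_cball a r (f : V -> R) M : 0 < r -> continuous f ->
  (forall z, euclidean_cball a r z -> `|f z| <= M) ->
  mu.-integrable (c @^-1` euclidean_cball a r) (fun t => (f (c t))%:E).
Proof.
move=> r0 cf fM; apply: (@bounded_integrable_cball a r (f \o c) M) => //.
  exact: continuous_measurable_tuple.
by move=> t; exact: fM.
Qed.

(** The form in which upper bounds are integrated: a constant, a term [L] of
    mean zero, and a loss [be] on a subset [A] of the ball. *)
Lemma ball_mean_le (u : V -> \bar R) (L : V -> R) (A : set V) (a : V) (r al be M : R) :
  0 < r -> continuous L -> (forall z, euclidean_cball a r z -> `|L z| <= M) ->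
  (\int[mu]_(t in c @^-1` euclidean_cball a r) (L (c t))%:E = 0)%E ->
  open A -> A `<=` euclidean_cball a r ->
  (forall z, euclidean_cball a r z -> (u z <= (al + L z - be * \1_A z)%:E)%E) ->
  (ball_mean u a r <= (al - be * vol A / vol (euclidean_cball a r))%:E)%E.
Proof.
move=> r0 cL LM L0 oA AB uL; rewrite /ball_mean -/(vol _).
have B0 := vol_cball_pos a r0.
have mB := measurable_cball a r.
have mA := open_measurable_tuple oA.
have Afin : (vol A)%:E = mu (c @^-1` A).
  rewrite /vol fineK // ge0_fin_numE ?measure_ge0 //.
  apply: le_lt_trans (vol_cball_lty a r0).
  by apply: le_measure; rewrite ?inE // => t; exact: AB.
suff intu : (\int[mu]_(t in c @^-1` euclidean_cball a r) u (c t) <=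
    (al * vol (euclidean_cball a r) - be * vol A)%:E)%E.
  apply: (@le_trans _ _ ((vol (euclidean_cball a r))^-1%:E *
    (al * vol (euclidean_cball a r) - be * vol A)%:E)%E).
    by apply: lee_wpmul2l => //; rewrite lee_fin invr_ge0 ltW.
  rewrite -EFinM lee_fin mulrC mulrBl mulfK //; exact: lt0r_neq0.
apply: (@le_trans _ _ (\int[mu]_(t in c @^-1` euclidean_cball a r)
   ((al)%:E + (L (c t))%:E + (- be)%:E * (\1_(c @^-1` A) t)%:E)))%E.
  by apply: integral_mono => t Bt; rewrite -EFinM -!EFinD mulNr; exact: uL.
have iL := integrable_cball r0 cL LM.
have iA : mu.-integrable (c @^-1` euclidean_cball a r) (fun t => (\1_(c @^-1` A) t)%:E).
  apply: (@bounded_integrable_cball a r (\1_(c @^-1` A)) 1) => //.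
  by move=> t _; rewrite indicE; case: (_ \in _); rewrite ?normr1 ?normr0.
have ic : mu.-integrable (c @^-1` euclidean_cball a r) (fun t => al%:E).
  by apply: (@integrable_cball a r (fun=> al) `|al|) => //; exact: cst_continuous.
rewrite integralD //; last 2 first.
- exact: integrableD.
- exact: integrableZl.
rewrite integralD // L0 adde0 integralZl // integral_indic // setIidl; last first.
  by move=> t; exact: AB.
rewrite integral_cst // [X in (al%:E * X + _)%E](vol_cballE a r0).
by rewrite [X in (_ + _ * X)%E](esym Afin) -!EFinM -EFinD mulNr.
Qed.

End ball_integrals.

(** * Reflections and rotations of balls *)

Section symmetric_integrals.
Context {R : realType}.
Local Notation mR := (measurableTypeR R).

(** The ball is invariant under the reflection in its centre, which changes
    the sign of [L]. *)
Lemma integral_odd_eq0 n (a : 'rV[R[i]]_n) (r : R) (L : 'rV[R[i]]_n -> R) (M : R) :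
  0 < r -> continuous L ->
  (forall z, euclidean_cball a r z -> `|L z| <= M) ->
  (forall z, L (a + a - z) = - L z) ->
  (\int[lebesgue_tuple (n + n)]_(t in @complex_of_tuple R n @^-1` euclidean_cball a r)
     (L (complex_of_tuple t))%:E = 0)%E.
Proof.
move=> r0 cL LM Lodd; set mu := lebesgue_tuple _; set B := _ @^-1` _.
have iL := integrable_cball r0 cL LM.
pose T (t : (n + n).-tuple mR) := [tuple (rcoord a k + rcoord a k) - tnth t k | k < n + n].
have TE t : complex_of_tuple (T t) = a + a - complex_of_tuple t.
  by apply: rcoord_inj => k; rewrite rcoordB rcoordD !rcoord_tuple tnth_mktuple.
have pT : measure_preserving mu T.
  apply: (@lebesgue_tuple_map R _ (fun k x => (rcoord a k + rcoord a k) - x)) => k.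
  exact: lebesgue_measure_reflect.
have TB : T @^-1` B = B.
  have aux z : a + a - z - a = - (z - a) by rewrite opprB addrAC addrK.
  apply/seteqP; split => t; rewrite /B !euclidean_cballE /= TE aux rnorm2N //.
have mB : measurable B := measurable_cball a r.
have mL : measurable_fun B (fun t => (L (complex_of_tuple t))%:E).
  by have /integrableP[] := iL.
have := integral_measure_preserving pT mB mL; rewrite TB.
under eq_integral do rewrite TE Lodd -mulN1r EFinM.
rewrite integralZl //; have := integrable_fin_num mB iL; rewrite -/B.
case: (integral _ _ _) => // x _ /eqP; rewrite -EFinM eqe => /eqP xx; congr EFin; lra.
Qed.

Local Notation V1 := 'rV[R[i]]_1.
Local Notation c1 := (@complex_of_tuple R 1).
Local Notation mu2 := (@lebesgue_tuple R (1 + 1)).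

Definition rot (a : V1) (w : R[i]) (z : V1) : V1 := a + w *: (z - a).

Lemma continuous_rot a w : continuous (rot a w).
Proof.
apply: continuous_entries => j.
have -> : (fun z : V1 => rot a w z ord0 j) = (fun z => a ord0 j + w * (z ord0 j - a ord0 j)).
  by apply/funext => z; rewrite !mxE.
move=> z; apply: cvgD; first exact: cvg_cst.
apply: cvgM; first exact: cvg_cst.
by apply: cvgB; [exact: continuous_entry|exact: cvg_cst].
Qed.

Lemma rot_comp a w1 w2 z : rot a w1 (rot a w2 z) = rot a (w1 * w2) z.
Proof. by rewrite /rot addrAC subrr add0r scalerA. Qed.

Lemma rot1 a z : rot a 1 z = z.
Proof. by rewrite /rot scale1r subrKC. Qed.

Lemma rot_cball a w r z : normc w = 1 ->
  euclidean_cball a r (rot a w z) <-> euclidean_cball a r z.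
Proof.
by move=> w1; rewrite euclidean_cballE /= /rot addrAC subrr add0r rnorm2Z w1 expr1n mul1r.
Qed.

Lemma measure_preserving_rot a w : normc w = 1 -> w != -1 ->
  measure_preserving mu2 (fun t => tuple_of_complex (rot a w (c1 t))).
Proof.
move=> w1 wN1.
have cs : Re w ^+ 2 + Im w ^+ 2 = 1.
  move: w1; case: (w) => x y /= h; rewrite -(@sqr_sqrtr _ (x ^+ 2 + y ^+ 2)) ?h ?expr1n //.
  by rewrite addr_ge0 ?sqr_ge0.
have cN1 : Re w != -1.
  apply: contraNneq wN1 => c1'; rewrite c1' in cs; rewrite [w]complexE c1'.
  have -> : Im w = 0 by apply/eqP; rewrite -sqrf_eq0; apply/eqP; lra.
  by rewrite mulr0 addr0 rmorphN.
pose sh (b : V1) (t : (1 + 1).-tuple mR) : (1 + 1).-tuple mR :=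
  [tuple tnth t k + rcoord b k | k < 1 + 1].
have psh b : measure_preserving mu2 (sh b).
  apply: (@lebesgue_tuple_map R _ (fun k x => x + rcoord b k)) => k.
  exact: lebesgue_measure_shift.
have := measure_preserving_comp (psh a)
  (measure_preserving_comp (lebesgue_tuple_rotate cs cN1) (psh (- a))).
congr measure_preserving; apply/funext => t; apply: eq_from_tnth => k.
rewrite /= tnth_mktuple tnth_mktuple /rot rcoordD addrC; congr (_ + _).
set z := c1 t - a.
have shE k' : tnth (sh (- a) t) k' = rcoord z k' by rewrite tnth_mktuple rcoordD rcoord_tuple.
have l0 : ord0 = lshift 1 (ord0 : 'I_1) by exact/val_inj.
have r0 : ord_max = rshift 1 (ord0 : 'I_1) by exact/val_inj.
rewrite /rotate2 !shE -(splitK k); case: (fintype.split k) => j; rewrite (ord1 j) /=.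
  rewrite rcoord_lshift mxE -l0 [LHS](tnth_nth 0) /= l0 r0 rcoord_lshift rcoord_rshift.
  by case: (w) (z _ _) => x y [x' y'].
rewrite rcoord_rshift mxE -r0 [LHS](tnth_nth 0) /= l0 r0 rcoord_lshift rcoord_rshift.
by case: (w) (z _ _) => x y [x' y'] /=; rewrite addrC.
Qed.

Lemma integral_rot a w r (f : V1 -> R) : normc w = 1 -> w != -1 -> continuous f ->
  (\int[mu2]_(t in c1 @^-1` euclidean_cball a r) (f (rot a w (c1 t)))%:E =
   \int[mu2]_(t in c1 @^-1` euclidean_cball a r) (f (c1 t))%:E)%E.
Proof.
move=> w1 wN1 cf; set B := _ @^-1` _.
have mf : measurable_fun B (fun t => (f (c1 t))%:E).
  by apply/measurable_EFinP; apply: measurable_funTS; exact: continuous_measurable_tuple.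
have := integral_measure_preserving (measure_preserving_rot a w1 wN1) (measurable_cball a r) mf.
rewrite [X in (\int[mu2]_(t in X) _)%E](_ : _ = B); last first.
  apply/funext => t; apply/propext.
  rewrite -[X in X <-> _]/(euclidean_cball a r (c1 (tuple_of_complex (rot a w (c1 t))))).
  by rewrite tuple_of_complexK; exact: rot_cball.
by move=> <-; apply: eq_integral => t _; rewrite tuple_of_complexK.
Qed.

Lemma integral_rot_exp a w r (f : V1 -> R) k : normc w = 1 -> w != -1 -> continuous f ->
  (\int[mu2]_(t in c1 @^-1` euclidean_cball a r) (f (rot a (w ^+ k) (c1 t)))%:E =
   \int[mu2]_(t in c1 @^-1` euclidean_cball a r) (f (c1 t))%:E)%E.
Proof.
move=> w1 wN1 cf; elim: k => [|k IH].
  by under eq_integral do rewrite expr0 rot1.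
rewrite -IH -(integral_rot a r w1 wN1 (f := fun z => f (rot a (w ^+ k) z))); last first.
  by move=> z; apply: continuous_comp; [exact: continuous_rot|exact: cf].
by under eq_integral do rewrite exprSr -rot_comp.
Qed.

(** Each of the [N] rotations leaves the integral over the disc unchanged. *)
Lemma integral_rot_mean a w r (f : V1 -> R) N M :
  normc w = 1 -> w != -1 -> continuous f -> 0 < r -> (0 < N)%N ->
  (forall z, euclidean_cball a r z -> `|f z| <= M) ->
  (\int[mu2]_(t in c1 @^-1` euclidean_cball a r)
     (N%:R^-1 * \sum_(k < N) f (rot a (w ^+ k) (c1 t)))%:E =
   \int[mu2]_(t in c1 @^-1` euclidean_cball a r) (f (c1 t))%:E)%E.
Proof.
move=> w1 wN1 cf r0 N0 fM; set B := _ @^-1` _.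
have wk k : normc (w ^+ k) = 1.
  by apply: (@complexI R); rewrite -[LHS]/(`|w ^+ k|) normrX -[`|w|]/((normc w)%:C%C) w1 expr1n.
have ck k : continuous (fun z => f (rot a (w ^+ k) z)).
  by move=> z; apply: continuous_comp; [exact: continuous_rot|exact: cf].
have bk k z : euclidean_cball a r z -> `|f (rot a (w ^+ k) z)| <= M.
  by move=> Bz; apply: fM; apply/rot_cball.
have ik k : mu2.-integrable B (fun t => (f (rot a (w ^+ k) (c1 t)))%:E).
  exact: (integrable_cball r0 (ck k) (bk k)).
have iS : mu2.-integrable B (fun t => \sum_(k < N) (f (rot a (w ^+ k) (c1 t)))%:E)%E.
  by apply: integrable_sum => //; exact: measurable_cball.
under eq_integral do rewrite EFinM -sumEFin.
rewrite integralZl //; last exact: measurable_cball.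
rewrite integral_sum //; last exact: measurable_cball.
under eq_bigr do rewrite integral_rot_exp //.
have := integrable_fin_num (measurable_cball a r) (integrable_cball r0 cf fM); rewrite -/B.
case: (integral _ _ _) => // x _.
by rewrite sumEFin -EFinM sumr_const card_ord -[X in _ * X]mulr_natl mulKf // pnatr_eq0 -lt0n.
Qed.

End symmetric_integrals.

(** * Harmonic polynomials on discs *)

Section harmonic_polynomials.
Context {R : realType}.
Local Notation V1 := 'rV[R[i]]_1.
Implicit Types (w x : R[i]) (q : {poly R[i]}).

(** Orders that are powers of two are enough: a [2^j]-th root of [-1] is a
    primitive root of unity of order [2^(j+1)]. *)
Lemma exists_root_of_unity d : exists N w,
  [/\ (d < N)%N, N.-primitive_root w, normc w = 1 & w != -1].
Proof.
pose j := d.+1; pose w : R[i] := (2 ^ j)%N.-root (-1).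
have wj : w ^+ (2 ^ j) = -1 by rewrite rootCK // expn_gt0.
have N11 : -1 != 1 :> R[i] by rewrite eq_sym -subr_eq0 opprK -(natrD _ 1 1) pnatr_eq0.
have wN : w ^+ (2 ^ j.+1) = 1 by rewrite expnSr exprM wj expr2 mulrNN mulr1.
have [|m wm] := prim_order_exists _ wN; first by rewrite expn_gt0.
move=> /(dvdn_pfactor _ _ (isT : prime 2))[e ej mE].
have ejE : e = j.+1.
  apply/eqP; rewrite eqn_leq ej ltnNge; apply/negP => ej'.
  have : w ^+ (2 ^ j) = 1.
    by apply/eqP; rewrite -(prim_order_dvd wm) mE dvdn_exp2l.
  by rewrite wj => /eqP; apply/negP.
exists (2 ^ j.+1)%N, w; split.
- by apply: ltn_trans (ltn_expl _ _) => //; rewrite /j.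
- by rewrite -ejE -mE.
- apply: (@complexI R); rewrite -[LHS]/(`|w|); apply/eqP.
  by rewrite -(@pexpr_eq1 _ _ (2 ^ j.+1)) ?expn_gt0 // -normrX wN normr1.
- apply: contraNneq N11 => wN1; rewrite -wj wN1 -signr_odd oddX /=.
  by [].
Qed.

Lemma sum_root_of_unity N w k : N.-primitive_root w -> (0 < k < N)%N ->
  \sum_(i < N) (w ^+ i) ^+ k = 0.
Proof.
move=> pw /andP[k0 kN].
have wk : w ^+ k != 1.
  by rewrite -(prim_order_dvd pw) gtnNdvd.
apply: (mulfI (x := w ^+ k - 1)); first by rewrite subr_eq0.
have <- : \sum_(i < N) (w ^+ k) ^+ i = \sum_(i < N) (w ^+ i) ^+ k.
  by apply: eq_bigr => i _; rewrite -!exprM mulnC.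
by rewrite mulr0 -subrX1 -exprM mulnC exprM (prim_expr_order pw) expr1n subrr.
Qed.

(** The mean value property of polynomials on circles, in discrete form: the
    average over the roots of unity kills all monomials of degrees between
    [1] and [N - 1]. *)
Lemma sum_horner_root_of_unity N w q x : N.-primitive_root w -> (size q <= N)%N ->
  \sum_(i < N) q.[w ^+ i * x] = N%:R * q.[0].
Proof.
move=> pw qN; have N0 := prim_order_gt0 pw.
under eq_bigr do rewrite (horner_coef_wide _ qN).
rewrite exchange_big /=.
case: N => // N in pw qN N0 *.
rewrite big_ord_recl /= [X in _ + X]big1 ?addr0; last first.
  move=> k _; under eq_bigr do rewrite exprMn mulrCA.
  have kN : (0 < lift ord0 k < N.+1)%N by rewrite (ltn_ord (lift ord0 k)).
  by rewrite -mulr_suml (sum_root_of_unity pw kN) mul0r.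
under eq_bigr do rewrite expr0 mulr1.
by rewrite sumr_const card_ord mulr_natl horner_coef0.
Qed.

Lemma continuous_horner_complex q : continuous (fun x : R[i] => q.[x]).
Proof.
elim/poly_ind: q => [|q b IH].
  by under eq_fun do rewrite horner0; exact: cst_continuous.
have -> : (fun x : R[i] => (q * 'X + b%:P).[x]) = (fun x => q.[x] * x + b).
  by apply/funext => x; rewrite hornerMXaddC.
move=> x; apply: cvgD; last exact: cvg_cst.
by apply: cvgM; [exact: IH|exact: cvg_id].
Qed.

Lemma compact_cball n (a : 'rV[R[i]]_n) r : 0 <= r -> compact (euclidean_cball a r).
Proof.
move=> r0; apply: (@bounded_closed_compactC R n _ (r + \sum_k `|rcoord a k|)).
  exact: closed_cball.
move=> z; rewrite euclidean_cballE /= => az k.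
rewrite -[z](subrK a) rcoordD; apply: le_trans (ler_normD _ _) _.
apply: lerD; first exact: rcoord_le_cball.
by rewrite (bigD1 k) //= lerDl sumr_ge0.
Qed.

Lemma cball_center n (a : 'rV[R[i]]_n) r : euclidean_cball a r a.
Proof. by rewrite euclidean_cballE /= subrr /rnorm2 rdot0r sqr_ge0. Qed.

Lemma continuous_cball_bounded n (f : 'rV[R[i]]_n -> R) a r : 0 <= r -> continuous f ->
  exists M, forall z, euclidean_cball a r z -> `|f z| <= M.
Proof.
move=> r0 cf.
have [||z _ zm] := usc_attains_max (compact_cball (a := a) r0) (f := fun z => (`|f z|)%:E).
- by exists a; exact: cball_center.
- move=> z x _; rewrite lte_fin => fz.
  have cn : `|f y| @[y --> z] --> `|f z| by apply: cvg_norm; exact: cf.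
  near=> y => _; rewrite lte_fin; near: y; exact: (cvgr_lt _ cn).
by exists `|f z| => y By; rewrite -lee_fin zm.
Unshelve. all: by end_near. Qed.

(** The harmonic part has mean [Re q.[0]] and the quadratic part lowers the
    mean. To see that the decrease is strict it suffices to look at a cube
    inside the disc and away from its centre. *)
Lemma ball_mean_harmonic_lt (v : V1 -> \bar R) (a : V1) r eps q : 0 < r -> 0 < eps ->
  (forall z, euclidean_cball a r z ->
    (v z <= (Re q.[z ord0 ord0 - a ord0 ord0] - eps * rnorm2 (z - a))%:E)%E) ->
  (ball_mean v a r < (Re q.[0])%:E)%E.
Proof.
move=> r0 e0 vq.
pose f (z : V1) := Re q.[z ord0 ord0 - a ord0 ord0].
have cf : continuous f.
  move=> z; apply: (@continuous_comp _ _ _ (fun z : V1 => q.[z ord0 ord0 - a ord0 ord0]));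
    last exact: continuous_Re.
  apply: (@continuous_comp _ _ _ (fun z : V1 => z ord0 ord0 - a ord0 ord0));
    last exact: continuous_horner_complex.
  by apply: cvgB; [exact: continuous_entry|exact: cvg_cst].
pose L z := f z - Re q.[0].
have cL : continuous L by move=> z; apply: cvgB; [exact: cf|exact: cvg_cst].
have [M LM] := continuous_cball_bounded a (ltW r0) cL.
have [N [w [qN pw w1 wN1]]] := exists_root_of_unity (size q).
have L0 : (\int[lebesgue_tuple (1 + 1)]_(t in @complex_of_tuple R 1 @^-1` euclidean_cball a r)
     (L (complex_of_tuple t))%:E = 0)%E.
  rewrite -(integral_rot_mean w1 wN1 cL r0 (prim_order_gt0 pw) LM).
  under eq_integral => t _.
    rewrite [X in X%:E](_ : _ = 0); first over.
    rewrite /L sumrB sumr_const card_ord /f.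
    rewrite (eq_bigr (fun k : 'I_N => Re q.[w ^+ k * (complex_of_tuple t ord0 ord0 - a ord0 ord0)])); last first.
      by move=> k _; rewrite !mxE addrAC subrr add0r.
    by rewrite -raddf_sum (sum_horner_root_of_unity _ pw (ltnW qN)) mulr_natl raddfMn /= subrr mulr0.
  by rewrite integral0.
(* Centre of a cube inside the disc on which [|z - a| >= r / 4]. *)
pose b : V1 := @of_rcoord R 1 (fun k : 'I_(1 + 1) => if k == ord0 then rcoord a k + r / 2 else rcoord a k).
have bE (k : 'I_(1 + 1)) : rcoord b k = if k == ord0 then rcoord a k + r / 2 else rcoord a k.
  exact: of_rcoordE.
have r4 : 0 < r / 4 by rewrite divr_gt0.
have rn (z : V1) : rnorm2 z = rcoord z ord0 ^+ 2 + rcoord z ord_max ^+ 2 :> R.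
  rewrite /rnorm2 /rdot big_ord_recl big_ord1 /= !expr2.
  by congr (_ + rcoord z _ * rcoord z _); exact/val_inj.
have boxb (z : V1) : rbox b (r / 4) z ->
    `|rcoord (z - a) ord0 - r / 2| < r / 4 /\ `|rcoord (z - a) ord_max| < r / 4.
  move=> zb; rewrite !rcoordB; split.
    by have := zb ord0; rewrite bE eqxx opprD addrA.
  by have := zb ord_max; rewrite bE.
have bB : rbox b (r / 4) `<=` euclidean_cball a r.
  move=> z /boxb[]; rewrite euclidean_cballE /= rn !ltr_norml => /andP[h1 h2] /andP[h3 h4].
  nra.
apply: (@le_lt_trans _ _ (Re q.[0] - (eps * (r / 4) ^+ 2) * vol (rbox b (r / 4)) /
    vol (euclidean_cball a r))%:E).
  apply: (@ball_mean_le _ _ _ L _ _ _ _ _ M) => //; first exact: rbox_open.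
  move=> z Bz; apply: le_trans (vq z Bz) _; rewrite lee_fin /L -/(f z) addrCA subrr addr0.
  rewrite lerD2l lerN2 -mulrA ler_pM2l // indicE.
  have [/set_mem/boxb[zb _]|_] := boolP (z \in _); last by rewrite mulr0 rnorm2_ge0.
  rewrite mulr1; apply: le_trans _ (rcoord2_le (z - a) ord0).
  by move: zb; rewrite ltr_norml => /andP[h1 h2]; nra.
rewrite lte_fin ltrBlDr ltrDl divr_gt0 // ?vol_cball_pos // mulr_gt0 //.
  by rewrite mulr_gt0 // exprn_gt0.
by rewrite /vol vol_rbox //= exprn_gt0 // mulr_gt0.
Qed.

End harmonic_polynomials.

(** * Lipschitz majorants of semicontinuous functions *)

Section lipschitz_regularization.
Context {R : realType} {n : nat}.
Local Notation V := 'rV[R[i]]_n.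
Local Notation c := (@complex_of_tuple R n).
Local Notation mu := (@lebesgue_tuple R (n + n)).

(** The sum norm, because its triangle inequality needs no square roots. *)
Definition norm1 (z : V) : R := \sum_k `|rcoord z k|.

Lemma norm1D (z w : V) : norm1 (z + w) <= norm1 z + norm1 w.
Proof. by rewrite -big_split; apply: ler_sum => k _; rewrite rcoordD ler_normD. Qed.

Lemma norm1_ge0 z : 0 <= norm1 z.
Proof. exact: sumr_ge0. Qed.

Lemma norm10 : norm1 0 = 0.
Proof. by rewrite /norm1 big1 // => k _; rewrite rcoord0 normr0. Qed.

Lemma continuous_norm1 (a : V) : continuous (fun z : V => norm1 (z - a)).
Proof.
apply: continuous_big => [|k _ z]; first exact: add_continuous.
have -> : (fun z : V => `|rcoord (z - a) k|) = (fun z => `|rcoord z k - rcoord a k|).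
  by apply/funext => x; rewrite rcoordB.
by apply: cvg_norm; apply: cvgB; [exact: continuous_rcoord|exact: cvg_cst].
Qed.

Lemma lipschitz_continuous (f : V -> R) (L : R) :
  (forall z w : V, f z <= f w + L * norm1 (z - w)) -> continuous f.
Proof.
move=> fL z; apply/cvgrPdist_lt => e e0.
have cL : (fun w : V => L * norm1 (w - z)) @ nbhs z --> L * norm1 (z - z).
  by apply: cvgM; [exact: cvg_cst|exact: continuous_norm1].
rewrite subrr norm10 mulr0 in cL.
near=> w.
have : `|0 - L * norm1 (w - z)| < e by near: w; move: e0; apply/cvgr_dist_lt.
rewrite sub0r normrN ltr_norml => /andP[_ h].
have sym : norm1 (z - w) = norm1 (w - z).
  by apply: eq_bigr => k _; rewrite !rcoordB distrC.
have := fL z w; have := fL w z; rewrite sym ltr_norml => h1 h2; lra.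
Unshelve. all: by end_near. Qed.

Context (B : set V) (w : V -> \bar R).
Context (B0 : B !=set0) (w0 : forall y, B y -> (0 <= w y)%E).

Definition trunc_at (k : nat) (y : V) : R := fine (mine (w y) k%:R%:E).

Lemma trunc_atE k y : B y -> (trunc_at k y)%:E = mine (w y) k%:R%:E.
Proof.
move=> By; rewrite /trunc_at fineK // fin_num_abs gee0_abs; last first.
  by rewrite le_min w0 // lee_fin ler0n.
by rewrite gt_min ltry orbT.
Qed.

(** The truncated inf-convolution. Truncating [w] at height [k] keeps the
    infimum finite where [w] is [+oo]; increasing the height together with the
    slope [k] makes the sequence nondecreasing. *)
Definition inf_conv (k : nat) (z : V) : R :=
  inf [set trunc_at k y + k%:R * norm1 (z - y) | y in B].

Let trunc_at_ge0 k y : B y -> 0 <= trunc_at k y.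
Proof. by move=> By; rewrite -lee_fin trunc_atE // le_min w0 // lee_fin ler0n. Qed.

Lemma inf_conv_le k z y : B y -> inf_conv k z <= trunc_at k y + k%:R * norm1 (z - y).
Proof.
move=> By; apply: ge_inf; last by exists y.
by exists 0 => _ [y' By' <-]; rewrite addr_ge0 ?trunc_at_ge0 // mulr_ge0 // norm1_ge0.
Qed.

Lemma le_inf_conv k z x : (forall y, B y -> x <= trunc_at k y + k%:R * norm1 (z - y)) ->
  x <= inf_conv k z.
Proof.
move=> h; apply: lb_le_inf; first by have [y By] := B0; eexists; exists y.
by move=> _ [y By <-]; exact: h.
Qed.

Lemma inf_conv_ge0 k z : 0 <= inf_conv k z.
Proof.
by apply: le_inf_conv => y By; rewrite addr_ge0 ?trunc_at_ge0 // mulr_ge0 // norm1_ge0.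
Qed.

Lemma inf_conv_lipschitz k z z' : inf_conv k z <= inf_conv k z' + k%:R * norm1 (z - z').
Proof.
rewrite -lerBlDr; apply: le_inf_conv => y By; rewrite lerBlDr.
apply: le_trans (inf_conv_le k z By) _; rewrite -addrA lerD2l -mulrDr ler_wpM2l //.
rewrite (_ : z - y = (z' - y) + (z - z')); first exact: norm1D.
by rewrite [RHS]addrC addrA subrK.
Qed.

Lemma continuous_inf_conv k : continuous (inf_conv k).
Proof. exact: lipschitz_continuous (inf_conv_lipschitz k). Qed.

Lemma inf_conv_le_fun k z : B z -> ((inf_conv k z)%:E <= w z)%E.
Proof.
move=> Bz; apply: (@le_trans _ _ (trunc_at k z)%:E).
  by rewrite lee_fin; have := inf_conv_le k z Bz; rewrite subrr norm10 mulr0 addr0.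
by rewrite trunc_atE // ge_min lexx.
Qed.

Lemma inf_conv_nondecreasing k k' z : (k <= k')%N -> inf_conv k z <= inf_conv k' z.
Proof.
move=> kk; apply: le_inf_conv => y By; apply: le_trans (inf_conv_le k z By) _.
have kk' : k%:R <= k'%:R :> R by rewrite ler_nat.
apply: lerD; last by rewrite ler_wpM2r // norm1_ge0.
by rewrite -lee_fin !trunc_atE // le_min !ge_min lexx lee_fin kk' orbT.
Qed.

(** Lower semicontinuity gives [w > x] on a cube of size [d] around [z].
    Points of the cube contribute at least [min (w, k) >= x], the others at
    least [k d >= x] once [k] is large. *)
Lemma inf_conv_approx z x : B z -> (forall x' : R, (x'%:E < w z)%E ->
    \forall y \near z, B y -> (x'%:E < w y)%E) ->
  (x%:E < w z)%E -> exists k, x <= inf_conv k z.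
Proof.
move=> Bz lsc xw; have /nbhs_rboxP[d d0 dB] := lsc _ xw.
(* Large enough for both [k >= x] and [k d >= x]. *)
pose k := (Num.truncn (`|x| / d + `|x|)).+1.
have k0 : 0 < k%:R :> R by rewrite ltr0n.
have xk : `|x| / d + `|x| <= k%:R.
  by have /andP[_ /ltW] := truncn_itv (addr_ge0 (divr_ge0 (normr_ge0 x) (ltW d0)) (normr_ge0 x)).
have xd : 0 <= `|x| / d by rewrite divr_ge0 // ltW.
exists k; apply: le_inf_conv => y By.
have [zy|] := pselect (rbox z d y).
  rewrite -[x]addr0 lerD //; last by rewrite mulr_ge0 // norm1_ge0.
  rewrite -lee_fin trunc_atE // le_min ltW /= ?lee_fin; last exact: dB.
  by have := ler_norm x; have := normr_ge0 x; lra.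
move=> /existsNP[j /negP]; rewrite -leNgt => zyd.
have : k%:R * d <= k%:R * norm1 (z - y).
  rewrite ler_pM2l // (le_trans zyd) // distrC -rcoordB /norm1 (bigD1 j) //= lerDl.
  exact: sumr_ge0.
have : `|x| <= k%:R * d.
  by rewrite -ler_pdivrMr //; have := normr_ge0 x; lra.
by have := trunc_at_ge0 k By; have := ler_norm x; lra.
Qed.

End lipschitz_regularization.

Section lipschitz_majorant.
Context {R : realType} {n : nat}.
Local Notation V := 'rV[R[i]]_n.
Local Notation c := (@complex_of_tuple R n).
Local Notation mu := (@lebesgue_tuple R (n + n)).

(** The inf-convolutions of [M - v] increase to [M - v], where [M] is an upper
    bound of [v] on the ball. By monotone convergence, if none of the
    corresponding majorants [M - inf_conv] of [v] had a mean below [v a],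
    neither would [v]. *)
Lemma lipschitz_majorant (v : V -> \bar R) (a : V) (r va : R) : 0 < r ->
  usc_on (euclidean_cball a r) v -> (forall z, euclidean_cball a r z -> (v z < +oo)%E) ->
  v a = va%:E -> ~ (v a <= ball_mean v a r)%E ->
  exists f L eta, [/\ 0 <= L, 0 < eta,
    forall z w : V, f z <= f w + L * norm1 (z - w),
    forall z, euclidean_cball a r z -> (v z <= (f z)%:E)%E &
    (\int[mu]_(t in c @^-1` euclidean_cball a r) (f (c t))%:E <=
      ((va - eta) * vol (euclidean_cball a r))%:E)%E].
Proof.
move=> r0 uv vlty vaE nomean.
set B := euclidean_cball a r in uv vlty nomean *.
have Ba : B a by exact: cball_center.
have B0 : B !=set0 by exists a.
have mB : measurable (c @^-1` B) := measurable_cball a r.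
have B_gt0 : 0 < vol B by exact: vol_cball_pos.
have [M vM] := usc_bounded_above (compact_cball (a := a) (ltW r0)) uv vlty.
pose w y := (M%:E - v y)%E.
have w0 y : B y -> (0 <= w y)%E.
  move=> By; rewrite /w; move: (vM y By); case: (v y) => [x||] //=; last by rewrite leey.
  by rewrite -EFinB !lee_fin subr_ge0.
have ltw x y : B y -> (x%:E < w y)%E = (v y < (M - x)%:E)%E.
  move=> By; rewrite /w; case: (v y) (vlty y By) => [u||] //= _.
    by rewrite -EFinB !lte_fin; apply/idP/idP => h; lra.
  by rewrite ltNyr ltry.
have lscw z : B z -> forall x, (x%:E < w z)%E -> \forall y \near z, B y -> (x%:E < w y)%E.
  move=> Bz x; rewrite ltw // => h; apply: filterS (uv z _ Bz h) => y hy By.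
  by rewrite ltw // hy.
pose F k t := (inf_conv B w k (c t))%:E.
have F_int k : mu.-integrable (c @^-1` B) (F k).
  have [K FK] := continuous_cball_bounded a (ltW r0) (continuous_inf_conv B0 w0 (k := k)).
  exact: (integrable_cball r0 (continuous_inf_conv B0 w0 (k := k)) FK).
have F_meas k : measurable_fun (c @^-1` B) (F k) by have /integrableP[] := F_int k.
have F_nd t : {homo F ^~ t : i j / (i <= j)%N >-> (i <= j)%E}.
  by move=> i j ij; rewrite lee_fin; exact: inf_conv_nondecreasing.
have F_cvg t : (c @^-1` B) t -> limn (F ^~ t) = w (c t).
  move=> Bt; apply/eqP; rewrite eq_le; apply/andP; split.
    apply: lime_le; first exact: ereal_nondecreasing_is_cvgn.
    by apply: nearW => k; exact: inf_conv_le_fun.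
  rewrite leNgt; apply/negP => lw.
  have [x lx xw] := real_between lw.
  have [k xk] := inf_conv_approx B0 w0 Bt (lscw _ Bt) xw.
  move: lx; rewrite ltNge => /negP; apply; apply: (@le_trans _ _ (F k t)).
    by rewrite lee_fin.
  apply: lime_ge; first exact: ereal_nondecreasing_is_cvgn.
  by exists k => // j kj; exact: F_nd.
have [k kX] : exists k, ~ (\int[mu]_(t in c @^-1` B) F k t <= ((M - va) * vol B)%:E)%E.
  apply: contrapT => noX; apply: nomean.
  have allX k : (\int[mu]_(t in c @^-1` B) F k t <= ((M - va) * vol B)%:E)%E.
    by apply: contrapT => h; apply: noX; exists k.
  have intw : (\int[mu]_(t in c @^-1` B) w (c t) <= ((M - va) * vol B)%:E)%E.
    rewrite (_ : integral _ _ _ = limn (fun k => \int[mu]_(t in c @^-1` B) F k t)%E).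
      apply: lime_le.
        apply: ereal_nondecreasing_is_cvgn => i j ij; apply: ge0_le_integral => //.
        - by move=> t _; rewrite lee_fin inf_conv_ge0.
        - by move=> t _; exact: F_nd.
      exact: nearW.
    rewrite -monotone_convergence //.
    - by apply: eq_integral => t; rewrite inE => Bt; rewrite F_cvg.
    - by move=> j t _; rewrite lee_fin inf_conv_ge0.
  have w_meas : measurable_fun (c @^-1` B) (fun t => w (c t)).
    apply: (emeasurable_fun_cvg F) => // t Bt; rewrite -F_cvg //.
    exact: ereal_nondecreasing_is_cvgn.
  have w_int : mu.-integrable (c @^-1` B) (fun t => w (c t)).
    apply/integrableP; split => //.
    rewrite (eq_integral (fun t => w (c t))); last first.
      by move=> t; rewrite inE => Bt; rewrite gee0_abs // w0.
    by apply: le_lt_trans intw _; exact: ltry.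
  have c_int : mu.-integrable (c @^-1` B) (fun=> M%:E).
    by apply: (@integrable_cball R n a r (fun=> M) `|M|) => //; exact: cst_continuous.
  have vE : (\int[mu]_(t in c @^-1` B) v (c t) =
      (M * vol B)%:E - \int[mu]_(t in c @^-1` B) w (c t))%E.
    rewrite EFinM -(vol_cballE a r0) -(integral_cst mu mB) -integralB //.
    apply: eq_integral => t; rewrite inE => Bt; rewrite /w /=.
    by case: (v (c t)) (vlty _ Bt) => [x||] //= _; rewrite -!EFinB; congr EFin; lra.
  have w_fin := integrable_fin_num mB w_int.
  rewrite /ball_mean -/B -/(vol B) [X in (_ * X)%E]vE vaE.
  move: intw w_fin; case: (integral _ _ _) => [I||] // + _; rewrite lee_fin => hI.
  rewrite -EFinB -EFinM lee_fin mulrC ler_pdivlMr //; lra.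
have := integrable_fin_num mB (F_int k); move: kX.
case IE : (integral _ _ _) => [Y||] //; rewrite lee_fin => /negP; rewrite -ltNge => XY _.
exists (fun z => M - inf_conv B w k z), k%:R, ((Y - (M - va) * vol B) / vol B); split => //.
- by rewrite divr_gt0 // subr_gt0.
- move=> z z'; have := inf_conv_lipschitz B0 w0 k z' z.
  have -> : norm1 (z' - z) = norm1 (z - z').
    by apply: eq_bigr => j _; rewrite !rcoordB distrC.
  lra.
- move=> z Bz; have := inf_conv_le_fun w0 k Bz; rewrite /w.
  case: (v z) (vlty z Bz) => [x||] //= _; last by rewrite leNye.
  by rewrite -EFinB !lee_fin; lra.
- rewrite (_ : integral _ _ _ = ((M * vol B)%:E - Y%:E)%E).
    rewrite -EFinB lee_fin mulrBl divfK ?lt0r_neq0 //; lra.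
  rewrite -IE EFinM -(vol_cballE a r0) -(integral_cst mu mB) -integralB //.
  by apply: (@integrable_cball R n a r (fun=> M) `|M|) => //; exact: cst_continuous.
Qed.

End lipschitz_majorant.

(** * Fejer sums and harmonic majorants *)

Section fejer.
Context {R : realType}.
Implicit Types (x y w : R[i]) (N : nat).

(** On the unit circle its real part is the Fejer kernel
    [|1 + x + ... + x^(N-1)|^2 / N]; the absolute value of [i - j] turns the
    double sum into a polynomial. *)
Definition fejer N : {poly R[i]} :=
  (N%:R^-1 : R)%:C%C *: \sum_(i < N) \sum_(j < N) 'X^(i - j + (j - i)).

Lemma size_fejer N : (size (fejer N) <= N)%N.
Proof.
apply: leq_trans (size_scale_leq _ _) _.
apply: leq_trans (size_sum _ _ _) _; apply/bigmax_leqP => i _.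
apply: leq_trans (size_sum _ _ _) _; apply/bigmax_leqP => j _.
rewrite size_polyXn; have [ij|ji] := leqP i j.
  by rewrite (eqP ij) add0n; apply: leq_ltn_trans (leq_subr _ _) (ltn_ord j).
by rewrite (eqP (ltnW ji)) addn0; apply: leq_ltn_trans (leq_subr _ _) (ltn_ord i).
Qed.

Lemma fejer0 N : (0 < N)%N -> (fejer N).[0] = 1.
Proof.
move=> N0; rewrite /fejer hornerZ horner_sum.
rewrite (eq_bigr (fun=> 1)); last first.
  move=> i _; rewrite horner_sum (bigD1 i) //= subnn addn0 expr0 hornerC big1 ?addr0 // => j ji.
  rewrite hornerXn expr0n addn_eq0 !subn_eq0 -eqn_leq.
  by rewrite (_ : (_ == _) = false) //; apply/negbTE; rewrite eq_sym in ji.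
rewrite sumr_const card_ord -[X in _ * X](rmorph_nat (real_complex R)) -rmorphM.
by rewrite mulVf // pnatr_eq0 -lt0n.
Qed.

Lemma fejer_unit_circle N x : normc x = 1 ->
  Re (fejer N).[x] = N%:R^-1 * normc (\sum_(j < N) x ^+ j) ^+ 2.
Proof.
move=> x1.
have xx : x * x^*%C = 1.
  by rewrite -sqr_normc norm_normc x1 expr1n.
rewrite /fejer hornerZ Re_realM horner_sum; congr (_ * _).
have normc2 y : normc y ^+ 2 = Re (y * y^*%C) by rewrite -sqr_normc norm_normc -rmorphXn.
rewrite normc2 rmorph_sum /= big_distrlr /= !raddf_sum; apply: eq_bigr => i _.
rewrite horner_sum !raddf_sum; apply: eq_bigr => j _; rewrite hornerXn rmorphXn /=.
have [ij|ji] := leqP i j.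
  rewrite (eqP ij) add0n -[in RHS](subnK ij) exprD mulrCA -exprMn xx expr1n mulr1.
  by rewrite -rmorphXn /=; case: (x ^+ _).
rewrite (eqP (ltnW ji)) addn0 -[in RHS](subnK (ltnW ji)) exprD -mulrA -exprMn xx expr1n mulr1.
by [].
Qed.

Lemma fejer_ge0 N x : normc x = 1 -> 0 <= Re (fejer N).[x].
Proof. by move=> x1; rewrite fejer_unit_circle // mulr_ge0 ?invr_ge0 // sqr_ge0. Qed.

(** The geometric sum equals [(x^N - 1) / (x - 1)]. *)
Lemma fejer_decay N x : normc x = 1 ->
  normc (x - 1) ^+ 2 * Re (fejer N).[x] <= 4 / N%:R.
Proof.
move=> x1; rewrite fejer_unit_circle // mulrCA -exprMn -normcM -subrX1 mulrC.
apply: ler_wpM2r; first by rewrite invr_ge0.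
have : normc (x ^+ N - 1) <= 2.
  apply: le_trans (le_normcD _ _) _; rewrite normcX x1 expr1n normcN.
  by rewrite [normc 1](_ : _ = 1) //= ?expr0n ?addr0 ?expr1n ?sqrtr1.
by have := normc_ge0 (x ^+ N - 1); nra.
Qed.

Local Notation V1 := 'rV[R[i]]_1.

Lemma norm1_row1 (z : V1) : norm1 z <= 2 * normc (z ord0 ord0).
Proof.
rewrite /norm1 big_split_ord /= !big_ord1 rcoord_lshift rcoord_rshift mulrDl mul1r.
by apply: lerD; [exact: Re_normc_le|exact: Im_normc_le].
Qed.

Lemma rnorm2_row1 (z : V1) : rnorm2 z = normc (z ord0 ord0) ^+ 2.
Proof. by apply: (@complexI R); rewrite rnorm2E big_ord1 norm_normc rmorphXn. Qed.

(** The discrete convolution of [f] with the Fejer kernel, over [N] equally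
    spaced points of the circle through [z0] centred at [a]. *)
Definition fejer_sum N w (a z0 : V1) (f : V1 -> R) : {poly R[i]} :=
  (N%:R^-1 : R)%:C%C *: \sum_(k < N) (f (rot a (w^-1 ^+ k) z0))%:C%C *:
    (fejer N \Po ((w ^+ k / (z0 ord0 ord0 - a ord0 ord0)) *: 'X)).

Lemma fejer_sumE N w (a z0 : V1) (f : V1 -> R) x :
  Re (fejer_sum N w a z0 f).[x] = N%:R^-1 * \sum_(k < N)
    f (rot a (w^-1 ^+ k) z0) * Re (fejer N).[w ^+ k * (x / (z0 ord0 ord0 - a ord0 ord0))].
Proof.
rewrite /fejer_sum hornerZ Re_realM horner_sum raddf_sum; congr (_ * _).
apply: eq_bigr => k _; rewrite hornerZ -[LHS]/(Re _) Re_realM horner_comp [(_ *: 'X).[_]]hornerZ hornerX.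
by rewrite mulrAC mulrA.
Qed.

(** The kernel values add up to [N], so the error is an average of the terms
    [(f z - f z_k) * K_k], with [f z - f z_k <= 2 L |x0| t] where [t] is the
    distance from [1] at which the kernel is evaluated. The bound
    [t <= dl + t^2 / dl] splits each term into a multiple of [K_k], and one of
    [t^2 * K_k], which the decay of the kernel controls. *)
Lemma fejer_sum_approx N w (a z0 : V1) (f : V1 -> R) (L dl : R) :
  N.-primitive_root w -> normc w = 1 -> 0 <= L -> 0 < dl -> 4 / dl ^+ 2 <= N%:R ->
  (forall z z' : V1, f z <= f z' + L * norm1 (z - z')) ->
  z0 ord0 ord0 - a ord0 ord0 != 0 ->
  forall z : V1, normc (z ord0 ord0 - a ord0 ord0) = normc (z0 ord0 ord0 - a ord0 ord0) ->
  f z <= Re (fejer_sum N w a z0 f).[z ord0 ord0 - a ord0 ord0] +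
    4 * L * normc (z0 ord0 ord0 - a ord0 ord0) * dl.
Proof.
move=> pw w1 L0 dl0 Ndl fL; set x0 := z0 ord0 ord0 - a ord0 ord0 => x00 z.
set x := z ord0 ord0 - a ord0 ord0 => xx0.
have N0 : (0 < N)%N := prim_order_gt0 pw.
have N0' : 0 < N%:R :> R by rewrite ltr0n.
have s0 : 0 < normc x0.
  exact: normc_gt0.
pose K (k : nat) := Re (fejer N).[w ^+ k * (x / x0)].
pose F (k : nat) := f (rot a (w^-1 ^+ k) z0).
have y1 k : normc (w ^+ k * (x / x0)) = 1.
  by rewrite !normcM normcX w1 expr1n mul1r normcV xx0 mulfV // lt0r_neq0.
have sumK : \sum_(k < N) K k = N%:R.
  rewrite -raddf_sum (sum_horner_root_of_unity _ pw (size_fejer N)) fejer0 // mulr1.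
  by rewrite -(rmorph_nat (real_complex R)).
have w0 : w != 0 by apply: contra_eq_neq w1 => ->; rewrite /= expr0n addr0 sqrtr0 eq_sym oner_neq0.
have dist k : norm1 (z - rot a (w^-1 ^+ k) z0) <= 2 * (normc x0 * normc (w ^+ k * (x / x0) - 1)).
  apply: le_trans (norm1_row1 _) _; rewrite ler_wpM2l //.
  rewrite (_ : (z - _) ord0 ord0 = w^-1 ^+ k * x0 * (w ^+ k * (x / x0) - 1)).
    by rewrite !normcM !normcX normcV w1 invr1 expr1n mul1r.
  have -> : (z - rot a (w^-1 ^+ k) z0) ord0 ord0 = x - w^-1 ^+ k * x0.
    by rewrite !mxE opprD addrA.
  rewrite [RHS]mulrBr mulr1; congr (_ - _).
  by rewrite exprVn; field; rewrite x00 expf_neq0.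
have term k : (f z - F k) * K k <= 2 * L * normc x0 * (dl * K k + dl).
  have K0 : 0 <= K k by exact: fejer_ge0.
  have t0 := normc_ge0 (w ^+ k * (x / x0) - 1).
  have := fejer_decay N (y1 k); rewrite -/(K k).
  set t := normc _ in t0 * => tK.
  have tK' : t ^+ 2 * K k <= dl ^+ 2.
    apply: le_trans tK _; rewrite ler_pdivrMr // mulrC -ler_pdivrMr ?exprn_gt0 //.
  have fz : f z - F k <= L * (2 * (normc x0 * t)).
    rewrite lerBlDl; apply: le_trans (fL z (rot a (w^-1 ^+ k) z0)) _.
    by rewrite lerD2l ler_wpM2l.
  apply: le_trans (ler_wpM2r K0 fz) _.
  rewrite (_ : L * (2 * (normc x0 * t)) * K k = 2 * L * normc x0 * (t * K k)); last by ring.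
  apply: ler_wpM2l; first by apply: mulr_ge0; [exact: mulr_ge0|exact: ltW].
  rewrite -(ler_pM2l dl0) mulrDr -expr2.
  have : 0 <= (t - dl) ^+ 2 * K k by rewrite mulr_ge0 // sqr_ge0.
  by nra.
rewrite fejer_sumE -lerBlDl.
have -> : f z - N%:R^-1 * (\sum_(k < N) F k * K k) = N%:R^-1 * \sum_(k < N) (f z - F k) * K k.
  rewrite [in RHS](eq_bigr (fun k : 'I_N => f z * K k - F k * K k)); last by move=> k _; rewrite mulrBl.
  by rewrite sumrB -mulr_sumr sumK mulrBr [f z * _]mulrC mulKf // lt0r_neq0.
rewrite mulrC ler_pdivrMr //.
apply: (@le_trans _ _ (\sum_(k < N) 2 * L * normc x0 * (dl * K k + dl))).
  by apply: ler_sum => k _; exact: term.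
rewrite -mulr_sumr big_split /= -mulr_sumr sumK sumr_const card_ord -[dl *+ N]mulr_natl.
by rewrite le_eqVlt; apply/orP; left; apply/eqP; ring.
Qed.

(** The passage from means over discs to circles: some circle carries a set of
    [N] equally spaced points over which the Lipschitz majorant of [v] has an
    average below [v a]. Since [N] is fixed before the circle is found, the
    error of the Fejer sum has to be, and is, uniform in the circle. *)
Lemma harmonic_majorant (v : V1 -> \bar R) (a : V1) (r : R) : 0 < r ->
  usc_on (euclidean_cball a r) v -> (forall z, euclidean_cball a r z -> (v z < +oo)%E) ->
  ~ (v a <= ball_mean v a r)%E ->
  exists q s, [/\ 0 < s, s <= r, ((Re q.[0])%:E < v a)%E &
    forall z : V1, normc (z ord0 ord0 - a ord0 ord0) = s ->
      (v z < (Re q.[z ord0 ord0 - a ord0 ord0])%:E)%E].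
Proof.
move=> r0 uv vlty nomean.
have [va vaE] : exists va, v a = va%:E.
  have := vlty a (@cball_center R 1 a r); move: nomean.
  by case: (v a) => [x||] //; [exists x|rewrite leNye].
have [f [L [eta [L0 eta0 fL vf fint]]]] := lipschitz_majorant r0 uv vlty vaE nomean.
have cf : continuous f := lipschitz_continuous fL.
have [M fM] := continuous_cball_bounded a (ltW r0) cf.
(* With this [dl] the error [4 L r dl] of the Fejer sum is at most
   [eta / 4]. *)
pose dl := eta / (16 * (L * r + 1)).
have Lr0 : 0 < L * r + 1 by rewrite ltr_wpDl // mulr_ge0 // ltW.
have dl0 : 0 < dl by rewrite divr_gt0 // mulr_gt0.
have [N [w [NN pw w1 wN1]]] := @exists_root_of_unity R (Num.truncn (4 / dl ^+ 2)).
have N0 : (0 < N)%N := prim_order_gt0 pw.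
have Ndl : 4 / dl ^+ 2 <= N%:R.
  have /andP[_ /ltW h] := truncn_itv (divr_ge0 (ler0n _ 4) (sqr_ge0 dl)).
  by apply: le_trans h _; rewrite ler_nat.
have w'1 : normc w^-1 = 1 by rewrite normcV w1 invr1.
have w'N1 : w^-1 != -1 by rewrite -[-1]invrN1 (inj_eq invr_inj).
have [z0 Bz0 fz0] : exists2 z0, euclidean_cball a r z0 &
    N%:R^-1 * \sum_(k < N) f (rot a (w^-1 ^+ k) z0) < va - eta / 2.
  apply: contrapT => none; move: fint.
  rewrite -(integral_rot_mean w'1 w'N1 cf r0 N0 fM) => fint.
  have : (((va - eta / 2) * vol (euclidean_cball a r))%:E <=
    \int[lebesgue_tuple (1 + 1)]_(t in @complex_of_tuple R 1 @^-1` euclidean_cball a r)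
      (N%:R^-1 * \sum_(k < N) f (rot a (w^-1 ^+ k) (complex_of_tuple t)))%:E)%E.
    rewrite EFinM -vol_cballE // -integral_cst; last exact: measurable_cball.
    apply: integral_mono => t Bt; rewrite lee_fin leNgt; apply/negP => h; apply: none.
    by exists (complex_of_tuple t).
  move=> /le_trans/(_ fint); rewrite lee_fin ler_pM2r ?vol_cball_pos //; lra.
have z00 : z0 ord0 ord0 - a ord0 ord0 != 0.
  apply/eqP => z0a; move: fz0.
  rewrite (eq_bigr (fun=> f a)); last first.
    move=> k _; congr f; apply/rowP => j; rewrite (ord1 j) !mxE z0a mulr0 addr0 //.
  rewrite sumr_const card_ord -[X in _ * X]mulr_natl mulKf ?pnatr_eq0 -?lt0n // => fa.
  have := vf a (@cball_center R 1 a r); rewrite vaE lee_fin; lra.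
have s0 : 0 < normc (z0 ord0 ord0 - a ord0 ord0).
  exact: normc_gt0.
have sr : normc (z0 ord0 ord0 - a ord0 ord0) <= r.
  move: Bz0; rewrite euclidean_cballE /= rnorm2_row1 !mxE.
  by rewrite ler_pXn2r // nnegrE ?normc_ge0 // ltW.
have err : 4 * L * normc (z0 ord0 ord0 - a ord0 ord0) * dl <= eta / 4.
  have : 4 * (L * normc (z0 ord0 ord0 - a ord0 ord0)) * dl <= 4 * (L * r + 1) * dl.
    rewrite ler_pM2r // ler_pM2l //; have := ler_wpM2l L0 sr; lra.
  have -> : 4 * (L * r + 1) * dl = eta / 4 by rewrite /dl; field; rewrite lt0r_neq0.
  by rewrite !mulrA.
pose q := fejer_sum N w a z0 f + ((eta / 3)%:C%C)%:P.
have qE x : Re q.[x] = Re (fejer_sum N w a z0 f).[x] + eta / 3.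
  by rewrite /q hornerD hornerC raddfD.
exists q, (normc (z0 ord0 ord0 - a ord0 ord0)); split => //.
- rewrite vaE lte_fin qE fejer_sumE.
  rewrite (eq_bigr (fun k : 'I_N => f (rot a (w^-1 ^+ k) z0))); first by lra.
  by move=> k _; rewrite mul0r mulr0 fejer0 //= mulr1.
- move=> z zs.
  have Bz : euclidean_cball a r z.
    by rewrite euclidean_cballE /= rnorm2_row1 !mxE zs ler_pXn2r // nnegrE ?normc_ge0 // ltW.
  apply: le_lt_trans (vf z Bz) _; rewrite lte_fin qE.
  have := fejer_sum_approx pw w1 L0 dl0 Ndl fL z00 zs; lra.
Qed.

End fejer.

(** * Neighbourhoods of closed null sets *)

Section contact_points.
Context {R : realType} {n : nat}.

Local Notation V := 'rV[R[i]]_n.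
Local Notation c := (@complex_of_tuple R n).
Local Notation mu := (@lebesgue_tuple R (n + n)).
Local Notation m := (n + n)%N.

Lemma continuous_rdot (p : V) : continuous (fun z : V => rdot p z).
Proof.
apply: continuous_big => [|k _ z]; first exact: add_continuous.
by apply: cvgM; [exact: cvg_cst|exact: continuous_rcoord].
Qed.

(** The radius is [d / 2] so that cubes around points at sup-distance more than
    [d] are disjoint. *)
Definition nbhd_boxes (K : set V) (d : R) : set V := \bigcup_(z in K) rbox z (d / 2).

Lemma nbhd_boxes_open K d : open (nbhd_boxes K d).
Proof. by apply: bigcup_open => z _; exact: rbox_open. Qed.

(** The neighbourhoods decrease to [K] because [K] is closed, and have finite
    volume because it is bounded: continuity of the measure from above. *)
Lemma null_nbhd_small (K : set V) : closed K -> lebesgue_null K ->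
  (exists r, forall z, K z -> forall k, `|rcoord z k| <= r) ->
  forall e, 0 < e -> exists2 d0, 0 < d0 &
    forall d, 0 < d <= d0 -> (mu (c @^-1` nbhd_boxes K d) < e%:E)%E.
Proof.
move=> clK nullK [r Kr] e e0.
pose F N := c @^-1` nbhd_boxes K N.+1%:R^-1.
have mF N : measurable (F N) by apply: open_measurable_tuple; exact: nbhd_boxes_open.
have subN d d' : d <= d' -> nbhd_boxes K d `<=` nbhd_boxes K d'.
  move=> dd z [w Kw wz]; exists w => // k; apply: lt_le_trans (wz k) _.
  by rewrite ler_pM2r // invr_gt0.
have FE : \bigcap_N F N = c @^-1` K.
  apply/seteqP; split => t /=; last first.
    move=> Kt N _; exists (c t) => // k; rewrite subrr normr0 divr_gt0 //.
  move=> Ft; apply: clK => B /nbhs_rboxP[d d0 dB].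
  have [N Nd] := exists_invn_lt d0.
  have [z Kz zt] := Ft N Logic.I; exists z; split=> //; apply: dB => k.
  rewrite distrC; apply: lt_trans (zt k) (le_lt_trans _ Nd).
  by rewrite ler_pdivrMr // ler_peMr ?invr_ge0 // ler1n.
have F0 : (mu (F 0%N) < +oo)%E.
  have r0 : 0 < `|r| + 1 by rewrite ltr_wpDl.
  apply: (@le_lt_trans _ _ (mu (c @^-1` rbox 0 (`|r| + 1)))); last first.
    by rewrite vol_rbox // ltry.
  apply: le_measure; rewrite ?inE //; first exact: measurable_rbox.
  move=> t [z Kz zt] k; rewrite rcoord0 subr0.
  have := zt k; have := Kr z Kz k; have := ler_distD (rcoord z k) (rcoord (c t) k) 0.
  rewrite !subr0 invr1 => h1 h2 h3; apply: le_lt_trans h1 _; rewrite addrC.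
  have := ler_norm r; lra.
have capE : mu (\bigcap_N F N) = 0%E.
  by rewrite FE; apply/negligibleP => //; rewrite -FE; exact: bigcapT_measurable.
have cv : (mu \o F) N @[N --> \oo] --> mu (\bigcap_N F N).
  apply: nonincreasing_cvg_mu => //; first exact: bigcapT_measurable.
  move=> N1 N2 N12; apply/subsetPset => t; apply: subN.
  by rewrite lef_pV2 ?posrE // ler_nat.
rewrite capE in cv.
have [N _ /(_ N (leqnn N)) /= FN] : \forall N \near \oo, (mu (F N) < e%:E)%E.
  apply: (cv [set x | (x < e%:E)%E]); apply: open_nbhs_nbhs; split; last by rewrite /= lte_fin.
  exact: open_ereal_lt_ereal.
exists N.+1%:R^-1; first by rewrite invr_gt0.
move=> d /andP[d0 dN]; apply: le_lt_trans FN; apply: le_measure; rewrite ?inE //.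
  by apply: open_measurable_tuple; exact: nbhd_boxes_open.
by move=> t; exact: subN.
Qed.

(** The cubes of side [d] around the [z i] are disjoint and of volume
    [d ^+ m] each. *)
Lemma packing_nbhd N (K : set V) (z : 'I_N -> V) d : 0 < d ->
  (forall i, K (z i)) ->
  (forall i j, i != j -> exists k, d < `|rcoord (z i - z j) k|) ->
  ((N%:R * d ^+ m)%:E <= mu (c @^-1` nbhd_boxes K d))%E.
Proof.
move=> d0 Kz zd.
have mb i : measurable (c @^-1` rbox (z i) (d / 2)) by exact: measurable_rbox.
apply: (@le_trans _ _ (mu (\big[setU/set0]_(i < N) (c @^-1` rbox (z i) (d / 2))))); last first.
  apply: le_measure; rewrite ?inE.
  - by apply: bigsetU_measurable.
  - by apply: open_measurable_tuple; exact: nbhd_boxes_open.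
  - apply: (big_ind (fun A => A `<=` c @^-1` nbhd_boxes K d)) => //.
      by move=> A B AK BK t [/AK|/BK].
    by move=> i _ t it; exists (z i).
rewrite (measure_bigsetU_ord _ _ mb); last first.
  move=> i j _ _ [t [ti tj]]; apply/eqP/negP => /negP ij.
  have [k] := zd i j ij; rewrite rcoordB => dk.
  have := ti k; have := tj k; have := ler_distD (rcoord (c t) k) (rcoord (z i) k) (rcoord (z j) k).
  by rewrite (distrC (rcoord (z i) k) (rcoord (c t) k)); lra.
rewrite (eq_bigr (fun=> (d ^+ m)%:E)); last first.
  move=> i _; rewrite -[LHS]/(mu (c @^-1` rbox (z i) (d / 2))) vol_rbox ?divr_gt0 //.
  by congr ((_ ^+ _)%:E); field.
by rewrite sumEFin sumr_const card_ord mulr_natl.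
Qed.

End contact_points.

(** * Contact points of a subharmonic function *)

Section alexandrov.
Context {R : realType} {n : nat}.
Local Notation V := 'rV[R[i]]_n.
Local Notation c := (@complex_of_tuple R n).
Local Notation mu := (@lebesgue_tuple R (n + n)).
Local Notation m := (n + n)%N.

Definition slope_const : R := 8 * m%:R ^+ 2 * (16 * m%:R) ^+ m.

(** Let [q = p1 - p2] and let [h] be the difference of the two affine
    functions. As each bound touches [u] at its own point, [h] is nonnegative
    at [z2]; so [h >= |q_k| d / 2] on the cube of side [d / 2] that is moved
    away from [z2] in the direction of the signs of [q]. On the ball of radius
    [r = 2 m d] around [z1], which contains that cube, [u] is thus at most
    [u z1 + linear + C r^2 - (|q_k| d / 2) 1_cube]. The mean value
    inequality then bounds [(|q_k| d / 2) * vol cube] by [C r^2 * vol ball],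
    and comparing the ball with a cube of side [4 r] gives the constant. *)
Lemma contact_slope_lipschitz (Om Q : set V) (u : V -> \bar R) (phi : V -> R)
    (g : V -> V) (C : R) (p1 p2 z1 z2 : V) (al1 al2 d : R) :
  (0 < n)%N -> subharmonic Om u -> Q `<=` Om -> 0 <= C ->
  (forall z z', Q z -> Q z' ->
    phi z' <= phi z + rdot (g z) (z' - z) + C * rnorm2 (z' - z)) ->
  Q z1 -> Q z2 ->
  u z1 = (phi z1 + rdot p1 z1 + al1)%:E -> u z2 = (phi z2 + rdot p2 z2 + al2)%:E ->
  (forall y, Q y -> (u y <= (phi y + rdot p1 y + al1)%:E)%E) ->
  (forall y, Q y -> (u y <= (phi y + rdot p2 y + al2)%:E)%E) ->
  0 < d -> (forall k, `|rcoord (z1 - z2) k| <= d) ->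
  euclidean_cball z1 (2 * m%:R * d) `<=` Q ->
  forall k, `|rcoord (p1 - p2) k| <= slope_const * C * d.
Proof.
move=> n0 [_ _ su] QOm C0 semi Q1 Q2 u1 u2 up1 up2 d0 z12 BQ k.
set r := 2 * m%:R * d in BQ *; set q := p1 - p2.
have m1 : 1 <= m%:R :> R by rewrite ler1n addn_gt0 n0.
have r0 : 0 < r by rewrite /r; nra.
(* The signs of the coordinates of [q]. *)
pose sg j : R := if 0 <= rcoord q j then 1 else -1.
have sgE j : rcoord q j * sg j = `|rcoord q j|.
  by rewrite /sg; case: ger0P => h; rewrite ?mulr1 ?mulrN1.
have sg1 j : `|sg j| = 1 by rewrite /sg; case: ifP; rewrite ?normrN1 ?normr1.
pose b : V := z2 + of_rcoord (fun j => sg j * (3 / 4 * d)).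
have d4 : 0 < d / 4 by rewrite divr_gt0.
have bA y : rbox b (d / 4) y -> forall j,
    `|rcoord (y - z2) j - sg j * (3 / 4 * d)| < d / 4.
  by move=> yA j; have := yA j; rewrite /b rcoordD of_rcoordE rcoordB opprD addrA.
have rdotA y : rbox b (d / 4) y -> `|rcoord q k| * d / 2 <= rdot q (y - z2).
  move=> yA; have h j : `|rcoord q j| * d / 2 <= rcoord q j * rcoord (y - z2) j.
    have yj := bA _ yA j.
    rewrite -[rcoord (y - z2) j](subrK (sg j * (3 / 4 * d))) mulrDr mulrA sgE.
    have : `|rcoord q j * (rcoord (y - z2) j - sg j * (3 / 4 * d))| <= `|rcoord q j| * (d / 4).
      by rewrite normrM ler_wpM2l // ltW.
    rewrite ler_norml => /andP[h _].
    by have := normr_ge0 (rcoord q j); nra.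
  rewrite /rdot (bigD1 k) //= -[leLHS]addr0 lerD // sumr_ge0 // => j _.
  by apply: le_trans _ (h j); rewrite -mulrA mulr_ge0 // divr_ge0 // ltW.
have AB : rbox b (d / 4) `<=` euclidean_cball z1 r.
  move=> y yA; rewrite euclidean_cballE /=.
  apply: le_trans (rnorm2_le (r := 2 * d) _) _.
    move=> j; rewrite (_ : y - z1 = (y - z2) - (z1 - z2)); last by rewrite opprB addrA subrK.
    rewrite rcoordB; apply: le_trans (ler_normB _ _) _.
    have := z12 j; have := bA _ yA j => h1 h2.
    have : `|rcoord (y - z2) j| <= d.
      rewrite -[rcoord (y - z2) j](subrK (sg j * (3 / 4 * d))).
      apply: le_trans (ler_normD _ _) _; rewrite normrM sg1 mul1r gtr0_norm; last by nra.
      by lra.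
    lra.
  rewrite (_ : r ^+ 2 = m%:R * (m%:R * (2 * d) ^+ 2)); last by rewrite /r; ring.
  by rewrite ler_wpM2l // ler_peMl // sqr_ge0.
pose be := `|rcoord q k| * d / 2.
pose L y := rdot (g z1 + p1) (y - z1).
have cL : continuous L.
  move=> y; apply: (@continuous_comp _ _ _ (fun y : V => y - z1)); last exact: continuous_rdot.
  exact: continuous_subr_row.
have [M LM] := continuous_cball_bounded z1 (ltW r0) cL.
have Lodd y : L (z1 + z1 - y) = - L y.
  by rewrite /L -rdotNr; congr (rdot _ _); rewrite opprB addrAC addrK.
have L0 := integral_odd_eq0 r0 cL LM Lodd.
have uB y : euclidean_cball z1 r y ->
    (u y <= (phi z1 + rdot p1 z1 + al1 + C * r ^+ 2 + L y - be * \1_(rbox b (d / 4)) y)%:E)%E.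
  move=> By; have Qy := BQ _ By.
  have Cr : C * rnorm2 (y - z1) <= C * r ^+ 2.
    by apply: ler_wpM2l => //; move: By; rewrite euclidean_cballE.
  have phiy := semi _ _ Q1 Qy.
  have py : rdot p1 y = rdot p1 z1 + rdot p1 (y - z1) by rewrite rdotBr subrKC.
  rewrite indicE; have [/set_mem yA|_] := boolP (y \in _); last first.
    apply: le_trans (up1 y Qy) _; rewrite lee_fin /L rdotDl mulr0; lra.
  apply: le_trans (up2 y Qy) _; rewrite lee_fin /L rdotDl mulr1.
  have := rdotA y yA; rewrite -/be /q rdotBr !rdotBl => h.
  have : (u z2 <= (phi z2 + rdot p1 z2 + al1)%:E)%E by exact: up1.
  rewrite u2 lee_fin; lra.
have BOm : euclidean_cball z1 r `<=` Om by move=> y /BQ/QOm.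
have := su z1 r r0 BOm; rewrite u1 => /le_trans.
move=> /(_ _ (ball_mean_le r0 cL LM L0 (@rbox_open R n b (d / 4)) AB uB)).
rewrite lee_fin => h.
have vA : vol (rbox b (d / 4)) = (d / 2) ^+ m.
  by rewrite /vol vol_rbox //=; congr (_ ^+ _); field.
have vB : vol (euclidean_cball z1 r) <= (4 * r) ^+ m.
  by rewrite -lee_fin -vol_cballE // vol_cball_le.
have vB0 := vol_cball_pos z1 r0.
have {}h : be * (d / 2) ^+ m <= C * r ^+ 2 * (4 * r) ^+ m.
  have : be * vol (rbox b (d / 4)) / vol (euclidean_cball z1 r) <= C * r ^+ 2.
    by move: h; lra.
  rewrite ler_pdivrMr // vA => /le_trans; apply.
  by apply: ler_wpM2l => //; rewrite mulr_ge0 // sqr_ge0.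
have dm : 0 < (d / 2) ^+ m by rewrite exprn_gt0 // divr_gt0.
rewrite -(ler_pM2r dm) -(ler_pM2r (x := d / 2)) ?divr_gt0 //.
apply: le_trans (le_trans _ h) _; first by rewrite /be; nra.
rewrite (_ : 4 * r = 16 * m%:R * (d / 2)); last by rewrite /r; field.
rewrite [(16 * m%:R * (d / 2)) ^+ m]exprMn /slope_const /r le_eqVlt; apply/orP; left; apply/eqP.
move: ((16 * m%:R) ^+ m) ((d / 2) ^+ m) => X Y; by field.
Qed.

End alexandrov.

Section contact_point_off_null.
Context {R : realType} {n : nat}.
Local Notation V := 'rV[R[i]]_n.
Local Notation m := (n + n)%N.

Lemma ler1_dist_nat (a b : nat) : a != b -> 1 <= `|a%:R - b%:R| :> R.
Proof.
wlog ab : a b / (a < b)%N => [h ab|_].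
  have [ab'|ba|/eqP] := ltngtP a b; last by rewrite (negPf ab).
    exact: h.
  by rewrite distrC; apply: h => //; rewrite eq_sym.
by rewrite distrC -natrB ?(ltnW ab) // ger0_norm // ler1n subn_gt0.
Qed.

(** For all slopes [p] in a cube of size [ka] the perturbation varies on [Q]
    by at most half of the gap [dl] between [z0] and the boundary. So all contact points
    lie in the set [S] where [u - phi >= c1 + dl / 2], which keeps a distance
    [rho] from the complement of [U]; this leaves room for the balls of
    [contact_slope_lipschitz]. *)
Lemma contact_point_off_null (Om Q U K : set V) (u : V -> \bar R) (phi : V -> R)
    (g : V -> V) (C c1 : R) (z0 : V) :
  (0 < n)%N -> subharmonic Om u -> Q `<=` Om -> compact Q -> open U -> U `<=` Q ->
  closed K -> K `<=` Q -> lebesgue_null K -> continuous phi -> 0 <= C ->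
  (forall z z', Q z -> Q z' ->
    phi z' <= phi z + rdot (g z) (z' - z) + C * rnorm2 (z' - z)) ->
  (forall z, Q z -> ~ U z -> (u z < (phi z + c1)%:E)%E) ->
  U z0 -> ((phi z0 + c1)%:E < u z0)%E ->
  exists p z al, [/\ U z, ~ K z, u z = (phi z + rdot p z + al)%:E &
    forall y, Q y -> (u y <= (phi y + rdot p y + al)%:E)%E].
Proof.
move=> n0 su QOm cQ oU UQ clK KQ nullK cphi C0 semi bdry Uz0 uz0.
have [usc_u u_lty _] := su.
have Q0 := UQ _ Uz0.
have [u0 u0E gap] : exists2 u0 : R, u z0 = u0%:E & phi z0 + c1 < u0.
  have := u_lty z0 (QOm _ Q0); move: uz0; case: (u z0) => [x||] //; rewrite lte_fin => ? _.
  by exists x.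
pose dl := u0 - phi z0 - c1.
have dl0 : 0 < dl by rewrite /dl; lra.
have [R1 R10 QR1] := compact_bounded_rcoord cQ.
have m0 : 0 < m%:R :> R by rewrite ltr0n addn_gt0 n0.
pose S z := ((phi z + c1 + dl / 2)%:E <= u z)%E.
(* Makes the variation of a linear form with coordinates at most [ka] over
   [Q] at most [dl / 2]. *)
pose ka := dl / (4 * m%:R * R1).
have ka0 : 0 < ka by rewrite divr_gt0 // !mulr_gt0.
have kaE : m%:R * (ka * (2 * R1)) = dl / 2.
  by rewrite /ka; move: (m%:R : R) m0 => M M0; field; rewrite !lt0r_neq0.
pose contact p z al := [/\ Q z, S z, u z = (phi z + rdot p z + al)%:E &
    forall y, Q y -> (u y <= (phi y + rdot p y + al)%:E)%E].
have usc_uQ : usc_on Q u := usc_onW QOm usc_u.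
have contact_ex p : (forall k, `|rcoord p k| <= ka) -> exists zal, contact p zal.1 zal.2.
  move=> pka.
  have cpp : continuous (fun y => phi y + rdot p y).
    by move=> y; apply: cvgD; [exact: cphi|exact: continuous_rdot].
  have [|z Qz zmax] := usc_attains_max cQ _ (usc_on_subr cpp usc_uQ); first by exists z0.
  have := zmax z0 Q0; have := u_lty z (QOm _ Qz).
  rewrite u0E; case uzE : (u z) => [uz||] //= _.
  rewrite -!EFinB lee_fin => uz_ge.
  exists (z, uz - (phi z + rdot p z)); split => //=.
  - rewrite /S uzE lee_fin.
    have : `|rdot p (z - z0)| <= m%:R * (ka * (2 * R1)).
      apply: rdot_le => // k; rewrite rcoordB.
      by have := QR1 _ Qz k; have := QR1 _ Q0 k; have := ler_normB (rcoord z k) (rcoord z0 k); lra.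
    rewrite kaE rdotBr ler_norml => /andP[]; rewrite /dl in uz_ge *; lra.
  - by rewrite uzE; congr EFin; ring.
  - move=> y Qy; have := zmax y Qy; rewrite uzE.
    case: (u y) => [uy||] //=; last by move=> _; exact: leNye.
    by rewrite -!EFinB !lee_fin; lra.
have [rho rho0 SU] : exists2 r : R, 0 < r & forall z, Q z -> S z -> rbox z r `<=` U.
  apply: compact_uniform_rbox => // z Qz.
  have [Uz|nUz] := pselect (U z); first by left; exact: open_nbhs_nbhs.
  right; have : ((u z - (phi z)%:E) < (c1 + dl / 2)%:E)%E.
    have := bdry z Qz nUz; case: (u z) => [uz||] //.
      by rewrite -EFinB !lte_fin; lra.
    by move=> _; exact: ltNyr.
  move=> h; apply: filterS (usc_on_subr cphi usc_uQ Qz h) => y + Qy => /(_ Qy).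
  rewrite /S; case: (u y) => [uy||] //.
    by rewrite -EFinB lte_fin lee_fin; lra.
apply: contrapT => none.
have contactK p z al : contact p z al -> K z.
  move=> [Qz Sz uz um]; apply: contrapT => nKz; apply: none; exists p, z, al; split => //.
  by apply: (SU z Qz Sz) => k; rewrite subrr normr0.
(* Adding [1] keeps the constant positive. *)
pose C' := slope_const (R := R) (n := n) * C + 1.
have s0 : 0 <= slope_const (R := R) (n := n).
  by rewrite /slope_const !mulr_ge0 ?exprn_ge0 ?mulr_ge0.
have C'1 : 0 < C' by rewrite ltr_wpDl // mulr_ge0.
have c30 : 0 < (ka / (2 * C')) ^+ m by rewrite exprn_gt0 // divr_gt0 // mulr_gt0.
have [d0 d00 small] : exists2 d0, 0 < d0 & forall d, 0 < d <= d0 ->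
    (lebesgue_tuple m (@complex_of_tuple R n @^-1` nbhd_boxes K d) <
      ((ka / (2 * C')) ^+ m)%:E)%E.
  by apply: null_nbhd_small => //; exists R1 => z /KQ; exact: QR1.
pose dmin := Num.min d0 (rho / (4 * m%:R)).
have dmin0 : 0 < dmin by rewrite lt_min d00 divr_gt0 // mulr_gt0.
(* The mesh [ka / N] of the grid of slopes is [2 C' d]: by
   [contact_slope_lipschitz], distinct slopes have contact points at distance
   more than [d]. *)
pose N := (Num.truncn (ka / (2 * C') / dmin)).+1.
have N0 : 0 < N%:R :> R by rewrite ltr0n.
pose d := ka / (2 * C') / N%:R.
have kC : 0 < ka / (2 * C') by apply: divr_gt0 => //; apply: mulr_gt0.
have dd : 0 < d by exact: divr_gt0.
have ddmin : d <= dmin.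
  rewrite /d ler_pdivrMr // -ler_pdivrMl // mulrC ltW //.
  by have /andP[_] := truncn_itv (divr_ge0 (ltW kC) (ltW dmin0)).
have [ddd0 drho] : d <= d0 /\ 2 * m%:R * d < rho.
  move: ddmin; rewrite /dmin le_min => /andP[-> h]; split => //.
  apply: le_lt_trans (_ : 2 * m%:R * (rho / (4 * m%:R)) < rho).
    by apply: ler_wpM2l => //; rewrite mulr_ge0.
  move: (m%:R : R) m0 => M M0; rewrite [X in X < _](_ : _ = rho / 2); first by lra.
  by field; rewrite lt0r_neq0.
pose pt (f : {ffun 'I_m -> 'I_N}) : V := of_rcoord (fun k => ka / N%:R * (f k)%:R).
have pt_small f k : `|rcoord (pt f) k| <= ka.
  rewrite of_rcoordE ger0_norm; last by apply: mulr_ge0 => //; apply: divr_ge0; exact: ltW.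
  by rewrite mulrAC ler_pdivrMr // ler_pM2l // ler_nat ltnW.
have /choice[F FP] f : exists zal, contact (pt f) zal.1 zal.2 := contact_ex _ (pt_small f).
pose z (j : 'I_#|{ffun 'I_m -> 'I_N}|) := (F (enum_val j)).1.
have := @packing_nbhd R n _ K z d dd (fun j => contactK _ _ _ (FP _)) _.
rewrite leNgt => /(_ _)/negP; apply; last first.
  rewrite card_ffun !card_ord natrX -exprMn.
  have -> : N%:R * d = ka / (2 * C') by rewrite mulrC divfK // lt0r_neq0.
  by apply: small; rewrite dd ddd0.
move=> i j ij; apply: contrapT => noco.
have zij k : `|rcoord (z i - z j) k| <= d.
  by rewrite leNgt; apply/negP => h; apply: noco; exists k.
have [k fk] : exists k, enum_val i k != enum_val j k.
  apply: contrapT => h; move/eqP: ij; apply; apply: enum_val_inj; apply/ffunP => k.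
  by apply/eqP; apply: contrapT => /negP hk; apply: h; exists k.
have [Qi Si ui umi] := FP (enum_val i); have [Qj Sj uj umj] := FP (enum_val j).
have BQ : euclidean_cball (z i) (2 * m%:R * d) `<=` Q.
  move=> y; rewrite euclidean_cballE /= => yz; apply: UQ; apply: (SU _ Qi Si) => k'.
  rewrite -rcoordB; apply: le_lt_trans drho; apply: rcoord_le_cball => //.
  by apply: mulr_ge0; [exact: mulr_ge0|exact: ltW].
have kaN : 0 < ka / N%:R by exact: divr_gt0.
have := contact_slope_lipschitz n0 su QOm C0 semi Qi Qj ui uj umi umj dd zij BQ k.
rewrite rcoordB !of_rcoordE -mulrBr normrM (gtr0_norm kaN).
have := ler1_dist_nat fk; rewrite -/C' => h1 h2.
have : ka / N%:R <= slope_const (R := R) (n := n) * C * d.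
  by apply: le_trans h2; rewrite ler_peMr // ltW.
have -> : ka / N%:R = 2 * C' * d by rewrite /d; field; rewrite !lt0r_neq0.
rewrite /C'; apply/negP; rewrite -ltNge.
have : 0 <= slope_const (R := R) (n := n) * C * d by apply: mulr_ge0; [exact: mulr_ge0|exact: ltW].
by move: (slope_const * C) => X; nra.
Qed.

End contact_point_off_null.

(** * Tubes around a complex disc *)

Section complex_lines.
Context {R : realType} {n : nat}.
Local Notation V := 'rV[R[i]]_n.
Implicit Types (z w h : V) (x y : R[i]).

Lemma continuous_normc : continuous (fun x : R[i] => normc x).
Proof.
move=> x A /nbhs_ballP[e /= e0 eA]; apply/nbhs_ballP; exists e%:C%C => /=; first by rewrite ltcR.
move=> y xy; apply: eA; rewrite -ball_normE /=.
have {}xy : normc (x - y) < e by rewrite -ltcR -norm_normc.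
apply: le_lt_trans xy; rewrite ler_norml; apply/andP; split.
  rewrite lerNl opprB lerBlDr -[in leLHS](subrK x y) (_ : normc (x - y) = normc (y - x)).
    exact: le_normcD.
  by rewrite -normcN opprB.
by rewrite lerBlDr -[in leLHS](subrK y x); exact: le_normcD.
Qed.

Lemma continuous_cdot w : continuous (fun z => cdot z w).
Proof.
apply: continuous_big => [|j _ z]; first exact: add_continuous.
by apply: cvgM; [exact: continuous_entry|exact: cvg_cst].
Qed.

Lemma horner_bounded (q : {poly R[i]}) (s : R) : 0 <= s ->
  exists2 D, 0 <= D & forall x, normc x <= s -> normc q.[x] <= D.
Proof.
move=> s0; elim/poly_ind: q => [|q c [D D0 IH]].
  by exists 0 => // x _; rewrite horner0 /= expr0n addr0 sqrtr0.
exists (D * s + normc c); first by rewrite addr_ge0 ?mulr_ge0 // normc_ge0.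
move=> x xs; rewrite hornerMXaddC; apply: le_trans (le_normcD _ _) _.
by rewrite lerD2r normcM ler_pM ?normc_ge0 // IH.
Qed.

(** Only a second-order bound uniform on a disc is required. By induction on
    [q]: the remainder [E] for [q] and the remainder for [q * 'X + c] are
    related by [y * E + q'(x) * (y - x)^2]. *)
Lemma horner_taylor2 (q : {poly R[i]}) (s : R) : 0 <= s ->
  exists2 C, 0 <= C & forall x y, normc x <= s -> normc y <= s ->
    normc (q.[y] - q.[x] - q^`().[x] * (y - x)) <= C * normc (y - x) ^+ 2.
Proof.
move=> s0; elim/poly_ind: q => [|q c [C C0 IH]].
  exists 0 => // x y _ _; rewrite deriv0 !horner0 subrr mul0r subrr mul0r.
  by rewrite /= expr0n addr0 sqrtr0.
have [D D0 qD] := horner_bounded q^`() s0.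
exists (s * C + D); first by rewrite addr_ge0 // mulr_ge0.
move=> x y xs ys; rewrite derivD derivC addr0 derivM derivX mulr1 !hornerMXaddC hornerD hornerMX.
have -> : q.[y] * y + c - (q.[x] * x + c) - (q^`().[x] * x + q.[x]) * (y - x) =
  y * (q.[y] - q.[x] - q^`().[x] * (y - x)) + q^`().[x] * (y - x) ^+ 2 by ring.
apply: le_trans (le_normcD _ _) _; rewrite mulrDl; apply: lerD.
  by rewrite normcM -mulrA ler_pM ?normc_ge0 // IH.
by rewrite normcM normcX ler_wpM2r ?sqr_ge0 // qD.
Qed.

End complex_lines.

Section tube.
Context {R : realType} {n : nat}.
Local Notation V := 'rV[R[i]]_n.
Context (a b : V) (b0 : 0 < rnorm2 b).

(** Coordinates adapted to the line [a + C b]: [along z] is the complex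
    parameter of the orthogonal projection of [z] on the line, and [across z]
    is the component of [z - a] orthogonal to [b]. *)
Definition along (z : V) : R[i] := cdot (z - a) b / (rnorm2 b)%:C%C.

Definition across (z : V) : V := z - a - along z *: b.

Let bC : (rnorm2 b)%:C%C != 0 :> R[i].
Proof. by rewrite (inj_eq (@complexI R)) lt0r_neq0. Qed.

Lemma tube_split z : z = a + along z *: b + across z.
Proof. by rewrite /across addrC -addrA [- _ + _]addrC addrK subrK. Qed.

Lemma cdot_across z : cdot (across z) b = 0.
Proof. by rewrite cdotBl cdotZl cdot_self divfK // subrr. Qed.

Lemma rdot_line t (x : R[i]) : cdot t b = 0 -> rdot t (x *: b) = 0.
Proof. by move=> tb; rewrite rdotC rdot_Re_cdot cdotZr tb mulr0. Qed.

Lemma along_shift z (x : R[i]) t : cdot t b = 0 -> along (z + x *: b + t) = along z + x.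
Proof.
move=> tb; rewrite /along (_ : z + x *: b + t - a = (z - a) + x *: b + t).
  by rewrite !cdotDl cdotZl cdot_self tb addr0 mulrDl mulfK.
by apply/rowP => j; rewrite !mxE; ring.
Qed.

Lemma across_shift z (x : R[i]) t : cdot t b = 0 -> across (z + x *: b + t) = across z + t.
Proof.
move=> tb; rewrite /across along_shift // scalerDl.
by apply/rowP => j; rewrite !mxE; ring.
Qed.

Lemma along_center : along a = 0.
Proof. by rewrite /along subrr cdot0l mul0r. Qed.

Lemma across_center : across a = 0.
Proof. by rewrite /across along_center subrr scale0r subr0. Qed.

Lemma continuous_along : continuous along.
Proof.
move=> z; apply: cvgM; last exact: cvg_cst.
apply: (@continuous_comp V V R[i] (fun z : V => z - a) (fun z => cdot z b)).
  exact: continuous_subr_row.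
exact: continuous_cdot.
Qed.

Lemma continuous_across : continuous across.
Proof.
apply: continuous_entries => j.
have -> : (fun y : V => across y ord0 j) =
    (fun y => y ord0 j - a ord0 j - along y * b ord0 j).
  by apply/funext => x; rewrite !mxE.
move=> x; apply: cvgB.
  by apply: cvgB; [exact: continuous_entry|exact: cvg_cst].
by apply: cvgM; [exact: continuous_along|exact: cvg_cst].
Qed.

Lemma continuous_norm_along : continuous (fun z => normc (along z)).
Proof.
by move=> z; apply: (@continuous_comp V R[i] R along (fun x => normc x)); [exact: continuous_along|exact: continuous_normc].
Qed.

Lemma continuous_norm_across : continuous (fun z => rnorm2 (across z)).
Proof.
move=> z; apply: (@continuous_comp V V R across (fun t => rnorm2 t)); first exact: continuous_across.
have -> : (fun t : V => rnorm2 t) = (fun t => rnorm2 (t - 0)).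
  by apply/funext => t; rewrite subr0.
exact: continuous_rnorm2.
Qed.

Definition tube (s rho : R) : set V :=
  [set z | normc (along z) <= s /\ rnorm2 (across z) <= rho ^+ 2].

Definition open_tube (s rho : R) : set V :=
  [set z | normc (along z) < s /\ rnorm2 (across z) < rho ^+ 2].

Lemma closed_tube s rho : closed (tube s rho).
Proof.
apply: closedI.
  by apply: (preimage_closed (D := [set x | x <= s])) => [z _|];
    [exact: continuous_norm_along|exact: closed_le].
by apply: (preimage_closed (D := [set x | x <= rho ^+ 2])) => [z _|];
  [exact: continuous_norm_across|exact: closed_le].
Qed.

Lemma open_open_tube s rho : open (open_tube s rho).
Proof.
apply: openI.
  by apply: (open_comp (D := [set x | x < s])) => [z _|];
    [exact: continuous_norm_along|exact: open_lt].
by apply: (open_comp (D := [set x | x < rho ^+ 2])) => [z _|];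
  [exact: continuous_norm_across|exact: open_lt].
Qed.

Lemma compact_tube s rho : compact (tube s rho).
Proof.
have aux (x y : R) : x ^+ 2 <= y -> `|x| <= 1 + y.
  rewrite -(real_normK (num_real x)); have := normr_ge0 x.
  by move: `|x| => t t0 ty; have := sqr_ge0 (t - 1); nra.
apply: (@bounded_closed_compactC R n _ (\sum_k `|rcoord a k| + (1 + s ^+ 2 * rnorm2 b) + (1 + rho ^+ 2))).
  exact: closed_tube.
move=> z [zs zr] k.
have -> : rcoord z k = rcoord a k + rcoord (along z *: b) k + rcoord (across z) k.
  by rewrite {1}[z]tube_split rcoordD rcoordD.
apply: le_trans (ler_normD _ _) _; apply: lerD.
  apply: le_trans (ler_normD _ _) _; apply: lerD.
    by rewrite (bigD1 k) //= lerDl sumr_ge0.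
  apply: aux; apply: le_trans (rcoord2_le (along z *: b) k) _; rewrite rnorm2Z.
  rewrite ler_wpM2r ?rnorm2_ge0 // ler_pXn2r ?nnegrE ?normc_ge0 //.
  exact: le_trans (normc_ge0 _) zs.
by apply: aux; apply: le_trans (rcoord2_le (across z) k) zr.
Qed.

Lemma tube_pythagoras z z' :
  rnorm2 (z' - z) = normc (along z' - along z) ^+ 2 * rnorm2 b + rnorm2 (across z' - across z).
Proof.
have -> : z' - z = (across z' - across z) + (along z' - along z) *: b.
  rewrite {1}[z']tube_split {1}[z]tube_split scalerBl.
  by apply/rowP => j; rewrite !mxE; ring.
rewrite rnorm2D rnorm2Z rdot_line; last by rewrite cdotBl !cdot_across subrr.
by rewrite mulr0 addr0 addrC.
Qed.

(** Superharmonic perturbation of a harmonic function along the line, convex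
    penalty across it. *)
Definition test_fun (q : {poly R[i]}) (eps J : R) (z : V) : R :=
  Re q.[along z] - eps * normc (along z) ^+ 2 + J * rnorm2 (across z).

Lemma continuous_test_fun q eps J : continuous (test_fun q eps J).
Proof.
move=> z; apply: cvgD; last first.
  by apply: cvgM; [exact: cvg_cst|exact: continuous_norm_across].
apply: cvgB; last first.
  apply: cvgM; first exact: cvg_cst.
  by apply: cvgM; exact: continuous_norm_along.
apply: (@continuous_comp V R[i] R (fun z => q.[along z]) (fun x => Re x)); last exact: continuous_Re.
apply: (@continuous_comp V R[i] R[i] along (fun x => q.[x])); first exact: continuous_along.
exact: continuous_horner_complex.
Qed.

(** The terms of [test_fun] are expanded to second order in [along] and
    [across], whose increments are controlled by [tube_pythagoras]. The term
    in [- eps] has a remainder of the favourable sign. *)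
Lemma test_fun_semiconcave q eps J s rho : 0 <= s -> 0 <= eps -> 0 <= J ->
  exists (g : V -> V) (C : R), 0 <= C /\
    forall z z', tube s rho z -> tube s rho z' ->
      test_fun q eps J z' <= test_fun q eps J z + rdot (g z) (z' - z) + C * rnorm2 (z' - z).
Proof.
move=> s0 e0 J0; have [C C0 Cq] := horner_taylor2 q s0.
(* Complex derivative of the first two terms with respect to [along z]. *)
pose W z : R[i] := q^`().[along z] - (2 * eps)%:C%C * (along z)^*%C.
exists (fun z => ((W z)^*%C / (rnorm2 b)%:C%C) *: b + (2 * J)%:C%C *: across z).
exists (C / rnorm2 b + J); split; first by rewrite addr_ge0 // divr_ge0 // ltW.
move=> z z' [zs _] [zs' _].
have lin : rdot (((W z)^*%C / (rnorm2 b)%:C%C) *: b) (z' - z) = Re (W z * (along z' - along z)).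
  have conjX (x : R[i]) (k : R) : (x^*%C / k%:C%C)^*%C = x / k%:C%C.
    rewrite -[LHS]/(conjc _) rmorphM; congr (_ * _); first exact: conjcK.
  by rewrite [LHS]conjc_inv conjc_real.
  rewrite rdot_Re_cdot cdotZr conjX; congr Re; rewrite mulrAC -mulrA; congr (_ * _).
  rewrite -mulrBl -cdotBl; congr (cdot _ _ / _).
  by rewrite opprB addrA subrK.
have tr : rdot ((2 * J)%:C%C *: across z) (z' - z) = 2 * J * rdot (across z) (across z' - across z).
  rewrite rdotZl; congr (_ * _).
  have -> : z' - z = (across z' - across z) + (along z' - along z) *: b.
    rewrite {1}[z']tube_split {1}[z]tube_split scalerBl.
    by apply/rowP => j; rewrite !mxE; ring.
  by rewrite rdotDr (rdot_line _ (cdot_across z)) addr0.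
rewrite rdotDl lin tr /test_fun.
have A2 : rnorm2 (across z') = rnorm2 (across z) +
    2 * rdot (across z) (across z' - across z) + rnorm2 (across z' - across z).
  by rewrite -rnorm2D subrKC.
have L2 : normc (along z') ^+ 2 = normc (along z) ^+ 2 +
    2 * Re ((along z)^*%C * (along z' - along z)) + normc (along z' - along z) ^+ 2.
  by rewrite -normc_sqrD subrKC.
have WE : Re (W z * (along z' - along z)) =
    Re (q^`().[along z] * (along z' - along z)) -
    2 * eps * Re ((along z)^*%C * (along z' - along z)).
  by rewrite /W mulrBl raddfB; congr (_ - _); rewrite -Re_realM mulrA.
have Q2 : Re q.[along z'] <= Re q.[along z] + Re (q^`().[along z] * (along z' - along z)) +
    C * normc (along z' - along z) ^+ 2.
  have := le_trans (Re_normc_le _) (Cq _ _ zs zs').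
  by rewrite !raddfB ler_norml => /andP[_ ]; lra.
have P := tube_pythagoras z z'.
have n1 : 0 <= normc (along z' - along z) ^+ 2 by exact: sqr_ge0.
have n2 : 0 <= rnorm2 (across z' - across z) by exact: rnorm2_ge0.
have h1 : C * normc (along z' - along z) ^+ 2 <= C / rnorm2 b * rnorm2 (z' - z).
  rewrite -mulrA ler_wpM2l // mulrC ler_pdivlMr // P; lra.
have h2 : J * rnorm2 (across z' - across z) <= J * rnorm2 (z' - z).
  by rewrite ler_wpM2l // P lerDr mulr_ge0 // ltW.
have h3 : 0 <= eps * normc (along z' - along z) ^+ 2 by rewrite mulr_ge0.
rewrite A2 L2 WE [(C / rnorm2 b + J) * _]mulrDl; move: Q2 h1 h2 h3; clear.
move: (rdot (across z) _) (rnorm2 (z' - z)) (rnorm2 (across z' - _)) (rnorm2 (across z)) => t1 t2 t3 t4.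
move: (Re (q^`().[_] * _)) (Re (_ * (along z' - along z))) (Re q.[along z]) (Re q.[along z']) => t5 t6 t7 t8.
move: (normc (along z' - along z) ^+ 2) (normc (along z) ^+ 2) (C / rnorm2 b) => t9 t10 t11.
by move=> *; nra.
Qed.

End tube.

Section main.
Context {R : realType} {n : nat}.
Local Notation V := 'rV[R[i]]_n.
Local Notation V1 := 'rV[R[i]]_1.

Lemma mulmx_row1 (l : V1) (b : V) : l *m b = l ord0 ord0 *: b.
Proof. by apply/rowP => j; rewrite !mxE big_ord1. Qed.

Lemma continuous_line (a b : V) : continuous (fun l : V1 => a + l *m b).
Proof.
apply: continuous_entries => j.
have -> : (fun l : V1 => (a + l *m b) ord0 j) = (fun l => a ord0 j + l ord0 ord0 * b ord0 j).
  by apply/funext => l; rewrite mulmx_row1 !mxE.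
move=> l; apply: cvgD; first exact: cvg_cst.
by apply: cvgM; [exact: continuous_entry|exact: cvg_cst].
Qed.

Lemma ball_mean_const (x : \bar R) (a : V) (r : R) : 0 < r -> (x < +oo)%E ->
  (x <= ball_mean (fun=> x) a r)%E.
Proof.
move=> r0; case: x => [x||] // _; last by rewrite leNye.
rewrite /ball_mean integral_cst; last exact: measurable_cball.
rewrite -/(vol _) [X in (_ * (_ * X))%E]vol_cballE // -!EFinM lee_fin mulrC mulfK //.
by rewrite lt0r_neq0 // vol_cball_pos.
Qed.

(** On the circle itself the strict inequality [u < Re q] holds by assumption;
    by semicontinuity it persists near the circle, so on the part
    [normc (along z) = s] of the boundary of a thin tube. On the remaining
    part, [rnorm2 (across z) = rho ^+ 2], the term in [J] exceeds the upper
    bound of [u - phi] over the tube. *)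
Lemma tube_with_boundary_gap (Om : set V) (u : V -> \bar R) (a b : V) (q : {poly R[i]})
    (s eps : R) :
  0 < rnorm2 b -> 0 < s -> open Om -> usc_on Om u -> (forall z, Om z -> (u z < +oo)%E) ->
  (forall x : R[i], normc x <= s -> Om (a + x *: b)) ->
  (forall x : R[i], normc x = s -> (u (a + x *: b)%R < (Re q.[x])%:E)%E) ->
  exists rho J : R, [/\ 0 < rho, 0 <= J, tube a b s rho `<=` Om &
    forall z, tube a b s rho z -> ~ open_tube a b s rho z ->
      (u z < (test_fun a b q eps J z + eps * s ^+ 2)%:E)%E].
Proof.
move=> b0 s0 oOm uu ulty disc circle.
have disc0 z : tube a b s 0 z -> z = a + along a b z *: b.
  move=> [_]; rewrite expr0n => /rnorm2_eq0 t0.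
  by rewrite {1}(tube_split a b z) t0 addr0.
have cD := @compact_tube R n a b s 0.
have [d1 d10 Om1] : exists2 r : R, 0 < r & forall z, tube a b s 0 z -> True -> rbox z r `<=` Om.
  apply: compact_uniform_rbox => // z Dz; left; apply: open_nbhs_nbhs; split => //.
  by rewrite (disc0 z Dz); apply: disc; case: Dz.
pose phi0 z := Re q.[along a b z] - eps * normc (along a b z) ^+ 2.
have phi0E z : phi0 z = test_fun a b q eps 0 z by rewrite /test_fun mul0r addr0.
have cphi0 : continuous phi0.
  by rewrite (funext phi0E); exact: continuous_test_fun.
have uphi0 := usc_on_subr cphi0 uu.
have [d2 d20 gap2] : exists2 r : R, 0 < r & forall z, tube a b s 0 z ->
    normc (along a b z) = s -> rbox z r `<=`
      [set y | Om y -> (u y - (phi0 y)%:E < (eps * s ^+ 2)%:E)%E].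
  apply: compact_uniform_rbox => // z Dz.
  have [zs|/eqP zs] := pselect (normc (along a b z) = s).
    left; apply: uphi0; first by rewrite (disc0 z Dz); apply: disc; case: Dz.
    have := circle _ zs; rewrite -(disc0 z Dz) /phi0 zs.
    case: (u z) => [x||] //=; last by move=> _; exact: ltNyr.
    by rewrite -EFinB !lte_fin; lra.
  right; have lts : normc (along a b z) < s by rewrite lt_neqAle zs; case: Dz.
  have cn : normc (along a b y) @[y --> z] --> normc (along a b z).
    exact: continuous_norm_along.
  have near_lt : \forall y \near z, normc (along a b y) < s by exact: (cvgr_lt _ cn).
  by apply: filterS near_lt => y ys _ ys'; move: ys; rewrite ys' ltxx.
pose rho := Num.min d1 d2 / 2.
have rho0 : 0 < rho by rewrite divr_gt0 // lt_min d10.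
have [rd1 rd2] : rho < d1 /\ rho < d2.
  have : Num.min d1 d2 <= d1 by rewrite ge_min lexx.
  have : Num.min d1 d2 <= d2 by rewrite ge_min lexx orbT.
  have : 0 < Num.min d1 d2 by rewrite lt_min d10.
  by rewrite /rho; split; lra.
(* The projection of [z] on the line lies in the compact disc [tube s 0]. *)
pose foot z := a + along a b z *: b.
have footE z : foot z = a + along a b z *: b + 0 by rewrite addr0.
have foot_along z : along a b (foot z) = along a b z.
  by rewrite footE along_shift ?cdot0l // along_center add0r.
have foot_across z : across a b (foot z) = 0.
  by rewrite footE across_shift ?cdot0l // across_center addr0.
have foot_tube z : normc (along a b z) <= s -> tube a b s 0 (foot z).
  by move=> zs; split; rewrite ?foot_along // foot_across /rnorm2 rdot0r expr0n.
have foot_near z d : rho < d -> tube a b s rho z -> rbox (foot z) d z.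
  move=> rd [_ zr] k; rewrite -rcoordB (_ : z - foot z = across a b z); last first.
    by rewrite {1}(tube_split a b z) addrC addKr.
  by apply: le_lt_trans rd; apply: rcoord_le_cball => //; exact: ltW.
have tOm : tube a b s rho `<=` Om.
  move=> z Tz; apply: (Om1 (foot z)) => //; first by apply: foot_tube; case: Tz.
  exact: foot_near.
have [M uM] : exists M : R, forall z, tube a b s rho z -> (u z - (phi0 z)%:E <= M%:E)%E.
  apply: usc_bounded_above; first exact: compact_tube.
    exact: usc_onW tOm uphi0.
  by move=> z /tOm/ulty; case: (u z) => [x||] //= _; rewrite -?EFinB ltry.
exists rho, ((`|M - eps * s ^+ 2| + 1) / rho ^+ 2); split => //.
  by rewrite divr_ge0 ?sqr_ge0 // addr_ge0.
set J := _ / _.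
have JE : J * rho ^+ 2 = `|M - eps * s ^+ 2| + 1.
  by rewrite /J divfK // expf_neq0 // lt0r_neq0.
have J0 : 0 <= J by rewrite divr_ge0 ?sqr_ge0 // addr_ge0.
move=> z Tz nUz; have Omz := tOm z Tz.
have [zs zr] := Tz.
have test : test_fun a b q eps J z = phi0 z + J * rnorm2 (across a b z) by [].
have [zs'|zs'] := pselect (normc (along a b z) = s).
  have := gap2 (foot z) (foot_tube z zs) _ z (foot_near z d2 rd2 Tz) Omz.
  rewrite foot_along => /(_ zs').
  have : 0 <= J * rnorm2 (across a b z) by rewrite mulr_ge0 // rnorm2_ge0.
  rewrite test; case: (u z) => [x||] //=; last by move=> *; exact: ltNyr.
  by rewrite -EFinB !lte_fin; lra.
have zr' : rnorm2 (across a b z) = rho ^+ 2.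
  apply/eqP; rewrite eq_le zr /= leNgt; apply/negP => zr'; apply: nUz; split => //.
  by rewrite lt_neqAle zs andbT; apply/eqP.
have := uM z Tz; rewrite test zr' JE; have := ler_norm (M - eps * s ^+ 2).
case: (u z) => [x||] //=; last by move=> *; exact: ltNyr.
by rewrite -EFinB lee_fin lte_fin; lra.
Qed.

(** Moving along [b] leaves [across] unchanged and translates [along]; linear
    forms and the mixed term of [|l + x|^2] are real parts of polynomials. *)
Lemma test_fun_on_line (a b z p : V) (q : {poly R[i]}) (eps J al : R) :
  0 < rnorm2 b -> exists qz : {poly R[i]}, forall x : R[i],
  test_fun a b q eps J (z + x *: b) + rdot p (z + x *: b) + al =
    Re qz.[x] - eps * normc x ^+ 2.
Proof.
move=> b0; pose la := along a b z.
pose k := - eps * normc la ^+ 2 + J * rnorm2 (across a b z) + rdot p z + al.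
exists (q \Po ('X + la%:P) - (((2 * eps)%:C%C * la^*%C) *: 'X) + cdot b p *: 'X + (k%:C%C)%:P).
move=> x; rewrite !hornerE horner_comp !hornerE.
rewrite /test_fun -[z + x *: b]addr0 along_shift ?cdot0l // across_shift ?cdot0l // !addr0 -/la.
rewrite normc_sqrD rdotDr [rdot p (x *: b)]rdot_Re_cdot cdotZl !raddfD raddfN /=.
rewrite -[_%:C%C * _ * x]mulrA Re_realM [x + la]addrC [cdot b p * x]mulrC; ring.
Qed.

End main.

(** * Removal of closed null sets *)

Theorem theorem0p2 (R : realType) (n : nat) (n_gt0 : (0 < n)%N)
    (Om E : set 'rV[R[i]]_n) (u : 'rV[R[i]]_n -> \bar R)
    (Om_domain : domain Om)
    (E_sub : E `<=` Om)
    (E_closed : closed_in Om E)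
    (E_null : lebesgue_null E)
    (u_sh : subharmonic Om u)
    (u_psh : plurisubharmonic (Om `\` E) u) :
  plurisubharmonic Om u.
Proof.
have [oOm _ _] := Om_domain; have [F clF EF] := E_closed.
have [uu ulty _] := u_sh; have [_ _ psh] := u_psh.
split => // a0 b; split.
- exact: (usc_on_comp (@continuous_line _ _ a0 b) uu).
- by move=> l; exact: ulty.
move=> l0 r r0 disc; apply: contrapT => nomean.
have Oml0 : Om (a0 + l0 *m b) by apply: disc; exact: cball_center.
(* A degenerate line: the slice is constant. *)
have [b0|b_neq0] := pselect (rnorm2 b <= 0).
  apply: nomean; rewrite (rnorm2_eq0 b0).
  have -> : (fun l : 'rV_1 => u (a0 + l *m 0)) = (fun=> u (a0 + l0 *m 0)).
    by apply/funext => l; rewrite !mulmx0.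
  by apply: ball_mean_const => //; apply: ulty; rewrite -(rnorm2_eq0 b0).
have {}b_neq0 : 0 < rnorm2 b by rewrite ltNge; apply/negP.
pose v (l : 'rV[R[i]]_1) := u (a0 + l *m b).
pose a := a0 + l0 *m b.
have uv : usc_on (euclidean_cball l0 r) v.
  exact: (usc_onW disc (usc_on_comp (@continuous_line _ _ a0 b) uu)).
have vlty l : euclidean_cball l0 r l -> (v l < +oo)%E by move=> /disc; exact: ulty.
have [q [s [s0 sr q0 qs]]] := harmonic_majorant r0 uv vlty nomean.
have on_line (x : R[i]) : exists2 l : 'rV_1, a + x *: b = a0 + l *m b &
    l ord0 ord0 - l0 ord0 ord0 = x.
  exists (l0 + const_mx x); last by rewrite !mxE addrAC subrr add0r.
  by rewrite /a mulmxDl addrA; congr (_ + _); rewrite mulmx_row1 mxE.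
have disc_a (x : R[i]) : normc x <= s -> Om (a + x *: b).
  move=> xs; have [l -> lx] := on_line x; apply: disc.
  rewrite euclidean_cballE /= rnorm2_row1 !mxE lx.
  by rewrite ler_pXn2r ?nnegrE ?normc_ge0 ?(ltW r0) // (le_trans xs).
have circle_a (x : R[i]) : normc x = s -> (u (a + x *: b)%R < (Re q.[x])%:E)%E.
  by have [l -> <-] := on_line x => /qs.
have [ua uaE] : exists ua, u a = ua%:E.
  move: q0; rewrite /v -/a; have := ulty a Oml0.
  by case: (u a) => [x||] //; exists x.
have qua : Re q.[0] < ua by move: q0; rewrite /v -/a uaE lte_fin.
(* The term in [eps] uses up half of the gap between [u a] and [Re q.[0]]. *)
pose eps := (ua - Re q.[0]) / (2 * s ^+ 2).
have s2 : 0 < s ^+ 2 by rewrite exprn_gt0.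
have eps0 : 0 < eps by rewrite divr_gt0 ?subr_gt0 // mulr_gt0.
have epsE : eps * s ^+ 2 = (ua - Re q.[0]) / 2.
  by rewrite /eps; field; rewrite lt0r_neq0.
have [rho [J [rho0 J0 tubeOm gap]]] :=
  tube_with_boundary_gap eps b_neq0 s0 oOm uu ulty disc_a circle_a.
have [g [C [C0 semi]]] :=
  test_fun_semiconcave a b_neq0 q rho (ltW s0) (ltW eps0) J0.
pose Q := tube a b s rho; pose U := open_tube a b s rho.
have UQ : U `<=` Q by move=> z [zs zr]; split; exact: ltW.
have clK : closed (F `&` Q) by apply: closedI => //; exact: closed_tube.
have KE : F `&` Q `<=` E by move=> z [Fz Qz]; rewrite EF; split => //; exact: tubeOm.
have nullK : lebesgue_null (F `&` Q) by apply: negligibleS E_null => t; exact: KE.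
have Ua : U a.
  split; rewrite ?along_center ?across_center.
    by rewrite /= expr0n addr0 sqrtr0.
  by rewrite /rnorm2 rdot0r exprn_gt0.
have ua_gap : ((test_fun a b q eps J a + eps * s ^+ 2)%:E < u a)%E.
  rewrite uaE lte_fin epsE /test_fun along_center across_center /rnorm2 rdot0r.
  rewrite /= expr0n addr0 sqrtr0 expr0n !mulr0; lra.
have [p [z [al [Uz nKz uz um]]]] := contact_point_off_null n_gt0 u_sh tubeOm
  (@compact_tube _ _ a b s rho) (@open_open_tube _ _ a b s rho) UQ clK (@subIsetr _ F Q) nullK
  (@continuous_test_fun _ _ a b q eps J) C0 semi gap Ua ua_gap.
have nFz : ~ F z by move=> Fz; apply: nKz; split => //; exact: UQ.
have [qz qzE] := test_fun_on_line a z p q eps J al b_neq0.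
have near_z : nbhs (0 : 'rV[R[i]]_1) [set l | U (z + l *m b) /\ ~ F (z + l *m b)].
  have : nbhs (z + 0 *m b) (U `&` ~` F).
    rewrite mul0mx addr0; apply: open_nbhs_nbhs; split; last by split.
    by apply: openI; [exact: open_open_tube|exact: closed_openC].
  by move/(continuous_line (a := z) (b := b)).
have /nbhs_rboxP[d d0 dU] := near_z.
have d2 : 0 < d / 2 by rewrite divr_gt0.
have cballU : euclidean_cball (0 : 'rV[R[i]]_1) (d / 2) `<=`
    [set l | U (z + l *m b) /\ ~ F (z + l *m b)].
  move=> l; rewrite euclidean_cballE /= => ld; apply: dU => k; rewrite -rcoordB.
  by apply: le_lt_trans (rcoord_le_cball k (ltW d2) ld) _; lra.
have [_ _ mean] := psh z b.
have cballE : euclidean_cball (0 : 'rV[R[i]]_1) (d / 2) `<=`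
    [set l | (Om `\` E) (z + l *m b)].
  move=> l /cballU[/UQ/tubeOm Oml nFl]; split => //=.
  by rewrite EF => -[].
have := mean 0 (d / 2) d2 cballE; rewrite mul0mx addr0 leNgt => /negP; apply.
have -> : u z = (Re qz.[0])%:E.
  rewrite uz; congr EFin; have := qzE 0; rewrite scale0r addr0 => ->.
  by rewrite /= expr0n addr0 sqrtr0 expr0n mulr0 subr0.
apply: (ball_mean_harmonic_lt d2 eps0) => l Bl.
have [Ul _] := cballU l Bl.
apply: le_trans (um _ (UQ _ Ul)) _; rewrite lee_fin mulmx_row1 qzE mxE !subr0.
by rewrite rnorm2_row1.
Qed.
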